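(* Let $(\widehat{\mathcal P}^{{\rm ag},\bullet}_+,\widehat{\mathcal P}^{{\rm ag},\bullet}_-)$ denote the estimated communities obtained by applying $k$-means clustering with $k=2$ ($\bullet={\rm km}$) or mean threshold clustering ($\bullet={\rm mt}$) to the vector $\widehat\sigma^{\rm ag}$. Then there exist an integer $N_0$ and positive constants $K_1,K_2$ and $K_3$ depending only on $\lambda,p$ and $r_+$ such that $$\mathbb P\left(\mathrm{MR}(\widehat{\mathcal P}^{{\rm ag},\bullet}_+,\widehat{\mathcal P}^{{\rm ag},\bullet}_-)\ge K_1\left(\frac{N\log(T)\log(N\log(T))}{T}+\frac{\log(N)}{N}\right)\right)\le K_2\left(\sqrt{\frac NT}+\frac1N\right)$$ for all pairs $(T,N)$ for which $N\ge N_0$ and $T\ge\big(K_3N\log(T)\log(N\log(T))\big)\vee2$.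
   Context: Model. Fix $0<\lambda<1$, $0<\mu\le\lambda$, $0<p\le 1$ and $r_+,r_-\in(0,1)$ with $r_++r_-=1$. For each $N$, $[N]=\{1,\dots,N\}$ is partitioned into two deterministic sets $\mathcal P_+,\mathcal P_-$; with $r^N_a=|\mathcal P_a|/N$ ($a\in\{-,+\}$) it is assumed that $|r^N_+-r_+|\vee|r^N_--r_-|\le K_0N^{-1}$ for a fixed constant $K_0$ (regarded as absolute). Let $\theta=(\theta_{ij})_{i,j\in[N]}$ be i.i.d. $\mathrm{Ber}(p)$. Conditionally on $\theta$, $X=(X_t)_{t\in\mathbb Z}$, $X_t=(X_{1,t},\dots,X_{N,t})\in\{0,1\}^N$, is the (unique in law) stationary Markov chain such that, given $X_{t-1}=x$, the coordinates of $X_t$ are independent with $X_{i,t}\sim\mathrm{Ber}(p_{\theta,i}(x))$, where $$p_{\theta,i}(x)=\mu+(1-\lambda)\Big(\frac1N\sum_{j\in\mathcal P_+}\theta_{ij}x_j+\frac1N\sum_{j\in\mathcal P_-}\theta_{ij}(1-x_j)\Big).$$ $\mathbb P$ refers to the joint law of $(\theta,X)$. Estimators. The sample is $X_1,\dots,X_{T+1}$, $T\ge1$ an integer. $1_N\in\mathbb R^N$ is the all-ones vector. $\widehat m=\frac1T\sum_{t=1}^TX_t$, $\widehat\Sigma^{(1)}=\frac1T\sum_{t=1}^T(X_{t+1}-\widehat m)(X_t-\widehat m)^\top$, $\widehat\sigma^{\rm ag}=(\widehat\Sigma^{(1)})^\top1_N$. $k$-means clustering: $(\widehat{\mathcal P}^{\rm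 ag,km}_+,\widehat{\mathcal P}^{\rm ag,km}_-)$ is a partition of $[N]$ into two nonempty sets that is a global minimizer over partitions $(S,S^c)$ of $\sum_{i\in S}(\widehat\sigma^{\rm ag}_i-\widehat\mu_S)^2+\sum_{i\in S^c}(\widehat\sigma^{\rm ag}_i-\widehat\mu_{S^c})^2$, with $\widehat\mu_V=|V|^{-1}\sum_{i\in V}\widehat\sigma_i^{\rm ag}$; the label $+$ is given to the cluster with the larger mean. Mean threshold clustering: $\widehat{\mathcal P}^{\rm ag,mt}_+=\{i\in[N]:\widehat\sigma^{\rm ag}_i\ge N^{-1}\sum_{j=1}^N\widehat\sigma^{\rm ag}_j\}$ and $\widehat{\mathcal P}^{\rm ag,mt}_-=[N]\setminus\widehat{\mathcal P}^{\rm ag,mt}_+$. Misclassification rate of a partition $(\widehat{\mathcal P}_+,\widehat{\mathcal P}_-)$ of $[N]$: $\mathrm{MR}(\widehat{\mathcal P}_+,\widehat{\mathcal P}_-)=N^{-1}\big(|\widehat{\mathcal P}_+\cap\mathcal P_-|+|\widehat{\mathcal P}_-\cap\mathcal P_+|\big)$. *)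

(* Defs.v *)
From HB Require Import structures.
From mathcomp Require Import all_boot all_order all_algebra.
From mathcomp Require Import all_classical all_reals all_analysis.
Set Implicit Arguments.
Unset Strict Implicit.
Unset Printing Implicit Defensive.
Import Order.TTheory GRing.Theory Num.Theory.
Import numFieldNormedType.Exports.
Local Open Scope classical_set_scope.
Local Open Scope ring_scope.

Definition mutually_independent (d d' : measure_display)
    (Omega : measurableType d) (T' : measurableType d') (R : realType)
    (P : probability Omega R) (I : finType) (Y : I -> {RV P >-> T'}) : Prop :=
  forall (J : {set I}) (B : I -> set T'), (forall i, measurable (B i)) ->
    P (\bigcap_(i in [set` J]) (Y i @^-1` B i)) =
    (\prod_(i in J) P (Y i @^-1` B i))%E.

(* Conditional probability of A given B; only used when P B != 0. *)
Definition cond_prob (d : measure_display) (Omega : measurableType d)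
    (R : realType) (P : probability Omega R) (A B : set Omega) : R :=
  fine (P (A `&` B)) / fine (P B).

Definition state (N : nat) : finType := {ffun 'I_N -> bool}.

Section Model.
Context {R : realType} {N : nat}.
Implicit Types (lambda mu p : R) (Pplus : {set 'I_N}) (a : 'M[bool]_N).

(* The partition of [N] is given by P_+ = Pplus and P_- = ~: Pplus. *)

Definition spin_prob lambda mu Pplus a (i : 'I_N) (x : state N) : R :=
  mu + (1 - lambda) *
    (N%:R^-1 * (\sum_(j in Pplus) (a i j)%:R * (x j)%:R) +
     N%:R^-1 * (\sum_(j in ~: Pplus) (a i j)%:R * (1 - (x j)%:R))).

(* Given the previous state x, the coordinates are independent Bernoulli. *)
Definition transition lambda mu Pplus a (x y : state N) : R :=
  \prod_(i < N) bernoulli_pmf (spin_prob lambda mu Pplus a i x) (y i).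

Context {d : measure_display} {Omega : measurableType d}
  {P : probability Omega R}.
Implicit Types (theta : 'I_N * 'I_N -> {RV P >-> bool})
  (X : int -> 'I_N -> {RV P >-> bool}).

Definition iid_bernoulli p theta : Prop :=
  mutually_independent theta /\
  (forall ij, distribution P (theta ij) = bernoulli_prob p :> (set bool -> \bar R)).

Definition environment_event theta a : set Omega :=
  [set w | forall i j, theta (i, j) w = a i j].

Definition state_at X (t : int) (w : Omega) : state N := [ffun i => X t i w].

Definition path_event X (t : int) (n : nat) (x : nat -> state N) : set Omega :=
  [set w | forall k : nat, (k <= n)%N -> state_at X (t + k%:Z) w = x k].

Definition cond_stationary X (B : set Omega) : Prop :=
  forall (s t : int) (n : nat) (x : nat -> state N),
    cond_prob P (path_event X (t + s) n x) B =
    cond_prob P (path_event X t n x) B.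

Definition cond_markov X (B : set Omega) (Q : state N -> state N -> R) : Prop :=
  forall (t : int) (n : nat) (x : nat -> state N) (y : state N),
    P (path_event X t n x `&` B) != 0%E ->
    cond_prob P [set w | state_at X (t + n.+1%:Z) w = y]
                (path_event X t n x `&` B) = Q (x n) y.

Definition binary_graphical_model lambda mu p Pplus theta X : Prop :=
  iid_bernoulli p theta /\
  forall a, P (environment_event theta a) != 0%E ->
    cond_stationary X (environment_event theta a) /\
    cond_markov X (environment_event theta a) (transition lambda mu Pplus a).

End Model.

Section Estimators.
Context {R : realType} {N : nat}.
Implicit Types (x : nat -> 'cV[R]_N) (T : nat) (v : 'cV[R]_N)
  (S Pplus : {set 'I_N}).

Definition mean_hat x T : 'cV[R]_N :=
  T%:R^-1 *: \sum_(1 <= t < T.+1) x t.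

Definition Sigma1_hat x T : 'M[R]_N :=
  T%:R^-1 *: \sum_(1 <= t < T.+1)
    ((x t.+1 - mean_hat x T) *m (x t - mean_hat x T)^T).

Definition sigma_ag x T : 'cV[R]_N := (Sigma1_hat x T)^T *m const_mx 1.

Definition cluster_mean v S : R := #|S|%:R^-1 * \sum_(i in S) v i 0.

Definition kmeans_cost v S : R :=
  \sum_(i in S) (v i 0 - cluster_mean v S) ^+ 2 +
  \sum_(i in ~: S) (v i 0 - cluster_mean v (~: S)) ^+ 2.

Definition two_clusters S : bool := (S != finset.set0) && (~: S != finset.set0).

(* S is the cluster labelled +. Minimizers need not be unique, so this is a
   relation. *)
Definition is_kmeans v S : Prop :=
  [/\ two_clusters S,
      forall S', two_clusters S' -> kmeans_cost v S <= kmeans_cost v S' &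
      cluster_mean v (~: S) <= cluster_mean v S].

Definition mean_threshold v : {set 'I_N} :=
  [set i | N%:R^-1 * \sum_(j < N) v j 0 <= v i 0]%SET.

Definition misclassification_rate Pplus S : R :=
  N%:R^-1 * (#|S :&: ~: Pplus| + #|~: S :&: Pplus|)%:R.

End Estimators.

Inductive clustering_method := Kmeans | MeanThreshold.

Definition is_clustering (R : realType) (N : nat) (b : clustering_method)
    (v : 'cV[R]_N) (S : {set 'I_N}) : Prop :=
  match b with
  | Kmeans => is_kmeans v S
  | MeanThreshold => S = mean_threshold v
  end.

Definition sample (R : realType) (N : nat) (d : measure_display)
    (Omega : measurableType d) (P : probability Omega R)
    (X : int -> 'I_N -> {RV P >-> bool}) (w : Omega) (t : nat) : 'cV[R]_N :=
  \col_(i < N) (X t%:Z i w)%:R.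

(* Main.v *)
Require Import Defs.
From HB Require Import structures.
From mathcomp Require Import all_boot all_order all_algebra.
From mathcomp Require Import all_classical all_reals all_analysis.
From mathcomp Require Import ring lra.
Import Order.TTheory GRing.Theory Num.Theory.
Import numFieldNormedType.Exports.
Set Implicit Arguments.
Unset Strict Implicit.
Unset Printing Implicit Defensive.
Local Open Scope classical_set_scope.
Local Open Scope ring_scope.

(* Both clustering rules recover the communities exactly outside an event of
   probability O(1/N + 1/T), so the misclassification rate is 0 there.

   Given theta, the chain is X_t = b + A X_(t-1) + noise with
   A_ij = (1 - lambda) eps_j theta_ij / N, where eps = 1 on P_+ and -1 on P_-.
   The stationary covariance satisfies Sigma0 = D + A Sigma0 A^T with D
   diagonal.  When all row and column averages of theta over P_+ and P_- are
   close to their means, A is close to the rank one matrix with entries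
   (1 - lambda) p eps_j / N on group-constant vectors, which gives
   Sigma0 A^T 1 = g eps + const up to a small error in sup norm, with g bounded
   away from 0.

   The entries of sigma_ag concentrate around those of Sigma0 A^T 1: changing
   one coordinate of X_(t-1) moves every transition probability by at most
   (1 - lambda) / N, so the coordinatewise Lipschitz constants of Q^k f decay
   geometrically, and a bounded difference inequality for product Bernoulli
   laws, applied backwards along the chain, yields subgaussian bounds for sums
   of phi(X_t, X_(t+1)).  Here phi is the summand of sigma_ag, in which the
   conditional mean of the total activity is truncated at a level of order
   sqrt(N log T).

   A vector at small sup distance (relative to g) from g eps + const is split
   correctly by the mean threshold, and also by 2-means, because every point
   lies closest to the mean of its own optimal cluster. *)

(** The obstacle is the product of the total activity at time t + 1 with coordinate j at time t.
    Given X_t = x its centred mean is [lin_dev x * dev x j], and flipping x_j can change this by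
    about |lin_dev x|, which may be of order N. The variance proxy per time step would then be N^2,
    and T would have to exceed N^2. Typically |lin_dev| is only of order sqrt N, so a truncation
    level B of order sqrt(N log T) is never reached along the path except with probability O(1/T),
    and it lowers the proxy to order N log T. A fixed accuracy for all j at once then costs T >= K N
    (log T)^2, which [sample_size_bounds] extracts from the hypothesis on T. All errors in the
    signal are measured in sup norm: the rows of |A| sum to at most 1 - lambda, so every linear
    fixed-point equation is stable with constant 1/lambda. The signal g is bounded below through
    lambda, p and the community proportions alone, uniformly in mu, so all tolerances are constants.
    The stated rate enters only through its positivity, whence K1 = 1. *)

Lemma expR_le_quad (R : realType) (x : R) :
  x <= 2^-1 -> expR x <= 1 + x + 2 * x ^+ 2.
Proof.
move=> xh; have h := expR_ge1Dx (- x); rewrite expRN in h.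
have e0 := expR_gt0 x.
have : expR x * (1 - x) <= 1.
  by have := ler_wpM2l (ltW e0) h; rewrite divff ?lt0r_neq0.
(* After multiplication by 1 - x > 0 the quadratic becomes 1 + x^2 (1 - 2x), which is at least 1 for
   x <= 1/2; large negative x are allowed. *)
move=> ex; have x1 : 0 < 1 - x by lra.
have x2 : 0 <= x ^+ 2 * (1 - 2 * x) by apply: mulr_ge0; [exact: sqr_ge0|lra].
rewrite -(ler_pM2r x1); apply: le_trans ex _.
have -> : (1 + x + 2 * x ^+ 2) * (1 - x) = 1 + x ^+ 2 * (1 - 2 * x) by ring.
lra.
Qed.

(* Below 1/2 a quadratic bound on exp suffices; above 1/2 the range D is
   smaller than 2 D^2. *)
Lemma two_point_exp (R : realType) (q u v D : R) : 0 <= q <= 1 ->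
  `|u - v| <= D ->
  q * expR u + (1 - q) * expR v <= expR (q * u + (1 - q) * v + 2 * D ^+ 2).
Proof.
move=> /andP[q0 q1] uv.
have D0 : 0 <= D := le_trans (normr_ge0 _) uv.
set e := q * u + (1 - q) * v.
suff H : q * expR (u - e) + (1 - q) * expR (v - e) <= expR (2 * D ^+ 2).
  rewrite expRD.
  have -> : expR u = expR e * expR (u - e) by rewrite -expRD subrKC.
  have -> : expR v = expR e * expR (v - e) by rewrite -expRD subrKC.
  rewrite mulrCA [X in _ + X]mulrCA -mulrDr ler_pM2l ?expR_gt0//.
move: uv; rewrite ler_norml => /andP[uv1 uv2].
have ue : `|u - e| <= D.
  have -> : u - e = (1 - q) * (u - v) by rewrite /e; ring.
  rewrite normrM ger0_norm ?subr_ge0//.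
  have := normr_ge0 (u - v); have : `|u - v| <= D by rewrite ler_norml uv1 uv2.
  nra.
have ve : `|v - e| <= D.
  have -> : v - e = q * (v - u) by rewrite /e; ring.
  rewrite normrM ger0_norm// distrC.
  have := normr_ge0 (u - v); have : `|u - v| <= D by rewrite ler_norml uv1 uv2.
  nra.
have mean0 : q * (u - e) + (1 - q) * (v - e) = 0 by rewrite /e; ring.
have sq (z : R) : `|z| <= D -> z ^+ 2 <= D ^+ 2.
  by move=> zD; rewrite -[z ^+ 2]real_normK ?num_real// ler_sqr ?nnegrE.
have := sq _ ue; have := sq _ ve.
case: (leP D 2^-1) => Dh.
- move=> sv su.
  apply: le_trans (expR_ge1Dx _).
  move: ue ve; rewrite !ler_norml => /andP[_ ue] /andP[_ ve].
  have eu := expR_le_quad (le_trans ue Dh).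
  have ev := expR_le_quad (le_trans ve Dh).
  have A : q * expR (u - e) <= q * (1 + (u - e) + 2 * D ^+ 2).
    by apply: ler_wpM2l => //; lra.
  have B : (1 - q) * expR (v - e) <= (1 - q) * (1 + (v - e) + 2 * D ^+ 2).
    by apply: ler_wpM2l; rewrite ?subr_ge0//; lra.
  apply: le_trans (lerD A B) _; rewrite le_eqVlt; apply/orP; left; apply/eqP.
  transitivity (1 + (q * (u - e) + (1 - q) * (v - e)) + 2 * D ^+ 2); first by ring.
  by rewrite mean0 addr0.
- move=> _ _; move: ue ve; rewrite !ler_norml => /andP[_ ue] /andP[_ ve].
  have DD : D <= 2 * D ^+ 2 by nra.
  have : expR (u - e) <= expR (2 * D ^+ 2) by rewrite ler_expR; lra.
  have : expR (v - e) <= expR (2 * D ^+ 2) by rewrite ler_expR; lra.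
  nra.
Qed.

(** * Bounded differences for product Bernoulli laws *)

Section ProductBernoulli.
Context {R : realType} {I : finType}.
Local Notation S := {ffun I -> bool}.
Implicit Types (q D : I -> R) (f g : S -> R) (x y : S) (i j : I) (l : seq I).

Definition upd x i (b : bool) : S := [ffun j => if j == i then b else x j].

Definition bern_weight q x : R := \prod_i bernoulli_pmf (q i) (x i).

Definition bernE q f : R := \sum_x bern_weight q x * f x.

Definition coord_lip D f := forall x i b, `|f (upd x i b) - f x| <= D i.

(** Conditional expectation given all coordinates other than [i]. Iterating it along a list reduces
    statements about [bernE] to one coordinate at a time. *)
Definition avg1 q i f : S -> R :=
  fun x => q i * f (upd x i true) + (1 - q i) * f (upd x i false).

Definition avgs q l f : S -> R := foldr (avg1 q) f l.

Lemma updE x i b j : upd x i b j = if j == i then b else x j.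
Proof. by rewrite ffunE. Qed.

Lemma updK x i : upd x i (x i) = x.
Proof. by apply/ffunP => j; rewrite updE; case: eqP => [->|]. Qed.

Lemma upd_upd x i b c : upd (upd x i b) i c = upd x i c.
Proof. by apply/ffunP => j; rewrite !updE; case: eqP. Qed.

Lemma updC x i j b c : i != j ->
  upd (upd x i b) j c = upd (upd x j c) i b.
Proof.
move=> ij; apply/ffunP => k; rewrite !updE.
by case: (k =P j) => [->|//]; case: eqP => // ji; rewrite ji eqxx in ij.
Qed.

Lemma bern_weight_ge0 q x : (forall i, 0 <= q i <= 1) -> 0 <= bern_weight q x.
Proof. by move=> q01; apply: prodr_ge0 => i _; apply: bernoulli_pmf_ge0. Qed.

Lemma sum_bern_weight q : \sum_x bern_weight q x = 1.
Proof.
rewrite /bern_weight -(bigA_distr_bigA (fun i b => bernoulli_pmf (q i) b)).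
by apply: big1 => i _; rewrite big_bool /bernoulli_pmf /= subrKC.
Qed.

Lemma bernE_cst q c : bernE q (fun=> c) = c.
Proof. by rewrite /bernE -mulr_suml sum_bern_weight mul1r. Qed.

Lemma bernED q f g : bernE q (fun x => f x + g x) = bernE q f + bernE q g.
Proof. by rewrite /bernE -big_split; apply: eq_bigr => x _; rewrite mulrDr. Qed.

Lemma bernEZ q c f : bernE q (fun x => c * f x) = c * bernE q f.
Proof. by rewrite /bernE mulr_sumr; apply: eq_bigr => x _; rewrite mulrCA. Qed.

Lemma eq_bernE q f g : f =1 g -> bernE q f = bernE q g.
Proof. by move=> fg; apply: eq_bigr => x _; rewrite fg. Qed.

Lemma bernE_sum q (J : Type) (r : seq J) (P : pred J) (F : J -> S -> R) :
  bernE q (fun x => \sum_(j <- r | P j) F j x) = \sum_(j <- r | P j) bernE q (F j).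
Proof. by rewrite /bernE exchange_big; apply: eq_bigr => x _; rewrite mulr_sumr. Qed.

Lemma le_bernE q f g : (forall i, 0 <= q i <= 1) -> (forall x, f x <= g x) ->
  bernE q f <= bernE q g.
Proof.
by move=> q01 fg; apply: ler_sum => x _; apply: ler_wpM2l; rewrite ?bern_weight_ge0.
Qed.

(** Double both sums and pair each configuration with its flip at [i]: the two weights share the
    factor [rho] of the other coordinates, so the identity holds pair by pair. *)
Lemma bernE_avg1 q i f : bernE q (avg1 q i f) = bernE q f.
Proof.
pose flip x := upd x i (~~ x i).
have flipK : involutive flip.
  by move=> x; rewrite /flip upd_upd updE eqxx negbK updK.
have two (h : S -> R) : \sum_x h x + \sum_x h x = \sum_x (h x + h (flip x)).
  by rewrite big_split; congr (_ + _); apply: (reindex_inj (inv_inj flipK)).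
suff : bernE q (avg1 q i f) + bernE q (avg1 q i f) = bernE q f + bernE q f by lra.
rewrite /bernE !two; apply: eq_bigr => x _.
pose rho := \prod_(j | j != i) bernoulli_pmf (q j) (x j).
have wx : bern_weight q x = bernoulli_pmf (q i) (x i) * rho.
  by rewrite /bern_weight (bigD1 i).
have wf : bern_weight q (flip x) = bernoulli_pmf (q i) (~~ x i) * rho.
  rewrite /bern_weight (bigD1 i)//= updE eqxx; congr (_ * _).
  by apply: eq_bigr => j /negPf ji; rewrite updE ji.
rewrite wx wf /avg1 /flip !upd_upd /bernoulli_pmf.
by case E : (x i) => /=; rewrite -{1}E ?updK -?E ?updK; rewrite ?E; ring.
Qed.

Lemma bernE_avgs q l f : bernE q (avgs q l f) = bernE q f.
Proof. by elim: l => //= i l IH; rewrite bernE_avg1. Qed.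

Lemma avgs_indep q l f i x b : i \in l -> avgs q l f (upd x i b) = avgs q l f x.
Proof.
elim: l x => //= j l IH x; rewrite inE /avg1 => il.
have [->|ij] := eqVneq i j; first by rewrite !upd_upd.
by rewrite (negPf ij) /= in il; rewrite !(updC _ _ _ ij) !IH.
Qed.

Lemma indep_const f : (forall x i b, f (upd x i b) = f x) ->
  forall x y, f x = f y.
Proof.
move=> find x y.
have fd l : f (foldr (fun i z => upd z i (y i)) x l) = f x.
  by elim: l => //= i l IH; rewrite find.
rewrite -(fd (enum I)); congr f; apply/ffunP => i.
have : i \in enum I by rewrite mem_enum.
elim: (enum I) => //= j l IH; rewrite inE updE.
by case: eqP => [->//|_ /= /IH].
Qed.

(** Once every coordinate has been averaged out, the function is constant, hence equal to its own
    mean. *)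
Lemma bernE_avgs_enum q f x : bernE q f = avgs q (enum I) f x.
Proof.
rewrite -(bernE_avgs q (enum I)) -[RHS](bernE_cst q); apply: eq_bernE => y.
by apply: indep_const => z i b; apply: avgs_indep; rewrite mem_enum.
Qed.

Lemma coord_lip_avg1 q i D f : (forall i, 0 <= q i <= 1) ->
  coord_lip D f -> coord_lip D (avg1 q i f).
Proof.
move=> q01 fD x j b; rewrite /avg1.
have [->|ij] := eqVneq j i.
  by rewrite !upd_upd subrr normr0 (le_trans _ (fD x i b)).
rewrite !(updC _ _ _ ij).
have /andP[q0 q1] := q01 i.
have := fD (upd x i true) j b; have := fD (upd x i false) j b.
rewrite !ler_norml => /andP[a1 a2] /andP[b1 b2].
apply/andP; split; nra.
Qed.

Lemma coord_lip_avgs q l D f : (forall i, 0 <= q i <= 1) ->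
  coord_lip D f -> coord_lip D (avgs q l f).
Proof. by move=> q01 fD; elim: l => //= i l IH; apply: coord_lip_avg1. Qed.

Lemma avgs_lip_param q q' D f x l :
  (forall i, 0 <= q i <= 1) -> (forall i, 0 <= q' i <= 1) -> coord_lip D f ->
  `|avgs q l f x - avgs q' l f x| <= \sum_(i <- l) `|q i - q' i| * D i.
Proof.
move=> q01 q'01 fD; elim: l x => [|i l IH] x; first by rewrite subrr normr0 big_nil.
rewrite big_cons /= /avg1.
set u := avgs q l f; set u' := avgs q' l f.
have /andP[q0 q1] := q'01 i.
have h1 := IH (upd x i true); have h2 := IH (upd x i false).
have h3 : `|u (upd x i true) - u (upd x i false)| <= D i.
  by rewrite -(upd_upd x i false true); apply: coord_lip_avgs.
rewrite -/u -/u' in h1 h2.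
(* The first term changes the parameter of coordinate [i] alone, at cost |q i - q' i| times the
   oscillation of [u] there; the second averages the inductive differences with the new weights. *)
have -> : q i * u (upd x i true) + (1 - q i) * u (upd x i false) -
  (q' i * u' (upd x i true) + (1 - q' i) * u' (upd x i false)) =
  (q i - q' i) * (u (upd x i true) - u (upd x i false)) +
  (q' i * (u (upd x i true) - u' (upd x i true)) +
   (1 - q' i) * (u (upd x i false) - u' (upd x i false))) by ring.
apply: le_trans (ler_normD _ _) _; apply: lerD.
  by rewrite normrM ler_wpM2l.
apply: le_trans (ler_normD _ _) _; rewrite !normrM !(@ger0_norm _ (q' i)) ?(@ger0_norm _ (1 - q' i)) ?subr_ge0//.
move: h1 h2; set s := \sum_(_ <- _) _ => h1 h2.
have := ler_wpM2l q0 h1; have := ler_wpM2l (_ : 0 <= 1 - q' i) h2.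
by rewrite subr_ge0 => /(_ q1); lra.
Qed.

Lemma bernE_lip_param q q' D f :
  (forall i, 0 <= q i <= 1) -> (forall i, 0 <= q' i <= 1) -> coord_lip D f ->
  `|bernE q f - bernE q' f| <= \sum_i `|q i - q' i| * D i.
Proof.
move=> q01 q'01 fD; rewrite (bernE_avgs_enum q f [ffun=> true]).
rewrite (bernE_avgs_enum q' f [ffun=> true]).
by apply: le_trans (avgs_lip_param _ _ q01 q'01 fD) _; rewrite big_enum.
Qed.

(** Each coordinate is moved inside the exponential by [two_point_exp], which costs a factor exp(2
    D_i^2). Averaging does not worsen the Lipschitz constants, so the cost is the same at every
    stage. *)
Lemma bernE_exp q D f : (forall i, 0 <= q i <= 1) -> coord_lip D f ->
  bernE q (fun x => expR (f x)) <= expR (bernE q f + 2 * \sum_i D i ^+ 2).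
Proof.
move=> q01 fD.
have H l : bernE q (fun x => expR (f x)) <=
    bernE q (fun x => expR (avgs q l f x)) * expR (2 * \sum_(i <- l) D i ^+ 2).
  elim: l => [|i l IH]; first by rewrite big_nil mulr0 expR0 mulr1.
  apply: le_trans IH _; rewrite big_cons mulrDr expRD mulrA.
  apply: ler_wpM2r; first exact: expR_ge0.
  rewrite -(bernE_avg1 q i) mulrC -bernEZ; apply: le_bernE => // x /=.
  rewrite -expRD addrC; apply: two_point_exp => //.
  by rewrite -(upd_upd x i false true); apply: coord_lip_avgs.
apply: le_trans (H (enum I)) _; rewrite expRD big_enum; apply: ler_wpM2r.
  exact: expR_ge0.
rewrite -[leRHS](bernE_cst q) le_eqVlt; apply/orP; left; apply/eqP.
by apply: eq_bernE => x; rewrite -bernE_avgs_enum.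
Qed.

Lemma bernE_coordM q i f : (forall x b, f (upd x i b) = f x) ->
  bernE q (fun x => (x i)%:R * f x) = q i * bernE q f.
Proof.
move=> fi; rewrite -(bernE_avg1 q i) -bernEZ; apply: eq_bernE => x.
by rewrite /avg1 !updE eqxx !fi mul0r mulr0 addr0 mul1r.
Qed.

Lemma bernE_coord q i : bernE q (fun x => (x i)%:R) = q i.
Proof.
rewrite -[RHS]mulr1 -[X in _ * X](bernE_cst q) -bernE_coordM//.
by apply: eq_bernE => x; rewrite mulr1.
Qed.

End ProductBernoulli.

Lemma sum_sqr_le (R : realType) (I : finType) (D : I -> R) :
  (\sum_i D i) ^+ 2 <= #|I|%:R * \sum_i D i ^+ 2.
Proof.
set s := \sum_i D i ^+ 2.
have E : \sum_i \sum_j (D i ^+ 2 + D j ^+ 2) = 2 * (#|I|%:R * s).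
  under eq_bigr => i _ do rewrite big_split/= sumr_const -/s.
  by rewrite big_split/= sumr_const sumrMnl -/s -mulr_natl; ring.
suff : 2 * (\sum_i D i) ^+ 2 <= 2 * (#|I|%:R * s) by rewrite ler_pM2l.
rewrite -E expr2 mulr_suml mulr_sumr; apply: ler_sum => i _.
rewrite mulrA mulr_sumr; apply: ler_sum => j _.
have := sqr_ge0 (D i - D j); nra.
Qed.

(** Discards the error that remains after k iterations of the chain, by letting k tend to
    infinity. *)
Lemma geometric_slack (R : realType) (b x a c : R) : 0 <= b < 1 ->
  (forall k : nat, x <= a + b ^+ k * c) -> x <= a.
Proof.
move=> /andP[b0 b1] H.
have cv : (a + b ^+ k * c) @[k --> \oo] --> a.
  rewrite -[X in _ --> X]addr0; apply: cvgD; first exact: cvg_cst.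
  rewrite -[X in _ --> X](mul0r c); apply: cvgMr_tmp.
  by apply: cvg_expr; rewrite ger0_norm.
by apply: (cvgr_to_ge cv); near=> k; exact: H.
Unshelve. all: by end_near. Qed.

(** * Concentration for a contracting stationary chain with conditionally independent coordinates *)

Section Chain.
Context {R : realType} {I : finType}.
Local Notation S := {ffun I -> bool}.
Variables (lam : R) (q : S -> I -> R) (pi : S -> R).
Hypothesis lam01 : 0 < lam < 1.
Hypothesis I0 : (0 < #|I|)%N.
Hypothesis q01 : forall x i, 0 <= q x i <= 1.
Hypothesis qlip : forall x i j b,
  `|q (upd x j b) i - q x i| <= (1 - lam) / #|I|%:R.

Definition step (f : S -> R) : S -> R := fun x => bernE (q x) f.

Definition statE (f : S -> R) : R := \sum_x pi x * f x.

Hypothesis pi_ge0 : forall x, 0 <= pi x.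
Hypothesis pi_sum1 : \sum_x pi x = 1.
Hypothesis pi_step : forall f, statE (step f) = statE f.

Implicit Types (D u w : I -> R) (f g : S -> R) (phi : S -> S -> R)
  (H : (nat -> S) -> R) (s : nat -> S).

Definition mean_lip D : R := (\sum_i D i) / #|I|%:R.

Let n0 : 0 < #|I|%:R :> R. Proof. by rewrite ltr0n. Qed.

Lemma lip_ge0 D f i : coord_lip D f -> 0 <= D i.
Proof. by move=> /(_ [ffun=> true] i true); apply: le_trans. Qed.

Lemma mean_lip_ge0 D f : coord_lip D f -> 0 <= mean_lip D.
Proof.
move=> fD; rewrite divr_ge0 ?ler0n// sumr_ge0// => i _; exact: lip_ge0 fD.
Qed.

Lemma coord_lip_osc D f x y : coord_lip D f -> f x - f y <= \sum_i D i.
Proof.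
move=> fD; have H l : f x - f (foldr (fun i z => upd z i (y i)) x l) <= \sum_(i <- l) D i.
  elim: l => [|i l IH]; first by rewrite big_nil subrr.
  rewrite big_cons /=; set z := foldr _ _ _ in IH *.
  by have := fD z i (y i); rewrite ler_norml => /andP[]; lra.
move: (H (enum I)); rewrite big_enum; apply: le_trans; rewrite le_eqVlt; apply/orP; left; apply/eqP.
congr (_ - f _); apply/ffunP => i; have : i \in enum I by rewrite mem_enum.
by elim: (enum I) => //= j l IH; rewrite inE updE; case: eqP => [->|_ /IH].
Qed.

(** Flipping one coordinate of the past moves every parameter by at most (1 - lam)/n, so
    [bernE_lip_param] gives the same bound for each coordinate: one step replaces [D] by its average
    and contracts it. *)
Lemma coord_lip_step D f : coord_lip D f ->
  coord_lip (fun=> (1 - lam) * mean_lip D) (step f).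
Proof.
move=> fD x j b; apply: le_trans (bernE_lip_param _ _ fD) _ => //.
rewrite /mean_lip mulrCA mulr_suml; apply: ler_sum => i _.
by rewrite mulrC; apply: ler_wpM2l; rewrite ?qlip// (lip_ge0 i fD).
Qed.

Lemma mean_lip_cst (d : R) : mean_lip (fun=> d) = d.
Proof. by rewrite /mean_lip sumr_const -[d *+ _]mulr_natr mulfK// gt_eqF. Qed.

Lemma mean_lip_sqr D : #|I|%:R * mean_lip D ^+ 2 <= \sum_i D i ^+ 2.
Proof.
rewrite /mean_lip expr_div_n mulrA ler_pdivrMr ?exprn_gt0//.
by rewrite [leRHS]mulrC expr2 -mulrA ler_pM2l// sum_sqr_le.
Qed.

Lemma step_exp D f x : coord_lip D f ->
  step (fun y => expR (f y)) x <= expR (step f x + 2 * \sum_i D i ^+ 2).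
Proof. by move=> fD; exact: bernE_exp. Qed.

Lemma statE_cst c : statE (fun=> c) = c.
Proof. by rewrite /statE -mulr_suml pi_sum1 mul1r. Qed.

Lemma statED f g : statE (fun x => f x + g x) = statE f + statE g.
Proof. by rewrite /statE -big_split; apply: eq_bigr => x _; rewrite mulrDr. Qed.

Lemma statEZ c f : statE (fun x => c * f x) = c * statE f.
Proof. by rewrite /statE mulr_sumr; apply: eq_bigr => x _; rewrite mulrCA. Qed.

Lemma statE_sum (J : Type) (r : seq J) (P : pred J) (F : J -> S -> R) :
  statE (fun x => \sum_(j <- r | P j) F j x) = \sum_(j <- r | P j) statE (F j).
Proof. by rewrite /statE exchange_big; apply: eq_bigr => x _; rewrite mulr_sumr. Qed.

Lemma eq_statE f g : f =1 g -> statE f = statE g.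
Proof. by move=> fg; apply: eq_bigr => x _; rewrite fg. Qed.

Lemma le_statE f g : (forall x, f x <= g x) -> statE f <= statE g.
Proof. by move=> fg; apply: ler_sum => x _; apply: ler_wpM2l. Qed.

(** By stationarity [g] may be replaced by [step g], whose constants are (1 - lam) d, at the cost 2
    n d^2. After k repetitions only the oscillation n (1 - lam)^k d of the iterate remains, and
    [geometric_slack] removes it. *)
Lemma statE_exp_uniform (d : R) g : coord_lip (fun=> d) g ->
  statE (fun x => expR (g x)) <=
  expR (statE g + 2 / lam * #|I|%:R * d ^+ 2).
Proof.
move=> gd; have /andP[l0 l1] := lam01.
suff H k : statE (fun x => expR (g x)) <=
    expR (statE g + 2 / lam * #|I|%:R * d ^+ 2 + (1 - lam) ^+ k * (#|I|%:R * d)).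
  (* Positivity allows the limit to be taken in the exponent, after a logarithm. *)
  have P0 : 0 < statE (fun x => expR (g x)).
    rewrite /statE lt_def; apply/andP; split; last first.
      by apply: sumr_ge0 => x _; rewrite mulr_ge0 ?expR_ge0.
    apply/negP => /eqP E.
    suff : \sum_x pi x = 0 by rewrite pi_sum1 => /eqP; rewrite oner_eq0.
    apply: big1 => x _; apply/eqP.
    have W y : true -> 0 <= pi y * expR (g y) by rewrite mulr_ge0 ?expR_ge0.
    have : pi x * expR (g x) = 0 by apply: (psumr_eq0P _ E) => // y _; exact: W.
    by move/eqP; rewrite mulf_eq0 (gt_eqF (expR_gt0 _)) orbF.
  rewrite -(lnK P0) ler_expR; apply: (@geometric_slack _ (1 - lam) _ _ (#|I|%:R * d)).
    by apply/andP; split; lra.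
  by move=> k; rewrite -ler_expR lnK.
elim: k d g gd => [|k IH] d g gd.
  rewrite expr0 mul1r -[leRHS]statE_cst; apply: le_statE => x; rewrite ler_expR.
  have d0 : 0 <= 2 / lam * #|I|%:R * d ^+ 2.
    by rewrite mulr_ge0 ?sqr_ge0// mulr_ge0 ?ler0n// divr_ge0// ltW.
  have : g x - statE g <= #|I|%:R * d; last by lra.
  rewrite -[leLHS]statE_cst.
  have -> : statE (fun=> g x - statE g) = statE (fun y => g x - g y).
    rewrite statE_cst statED statE_cst; congr (_ + _).
    by rewrite -[LHS]mulN1r -statEZ; apply: eq_statE => y; rewrite mulN1r.
  rewrite -[leRHS]statE_cst; apply: le_statE => y.
  by rewrite mulr_natl -sumr_const; apply: coord_lip_osc gd.
rewrite -pi_step; apply: (@le_trans _ _ (statE (fun x =>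
  expR (2 * \sum_(i in I) d ^+ 2) * expR (step g x)))).
  by apply: le_statE => x; rewrite -expRD addrC; apply: step_exp.
have := IH _ _ (coord_lip_step gd); rewrite mean_lip_cst pi_step statEZ => {}IH.
apply: le_trans (ler_wpM2l (expR_ge0 _) IH) _; rewrite -expRD ler_expR.
rewrite sumr_const -[_ *+ #|_|]mulr_natl [_ ^+ k.+1]exprS.
set n := #|I|%:R; set c := (1 - lam) ^+ k.
(* The constant c = 2/lam satisfies 2 + c (1 - lam)^2 <= c, because (1 - lam)^2 <= 1 - lam; this
   closes the recursion. *)
have E : 2 * (n * d ^+ 2) + 2 / lam * n * ((1 - lam) * d) ^+ 2 <= 2 / lam * n * d ^+ 2.
  have -> : 2 / lam * n * d ^+ 2 = 2 * (n * d ^+ 2) + 2 / lam * n * ((1 - lam) * d ^+ 2).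
    by field; rewrite gt_eqF.
  rewrite lerD2l; apply: ler_wpM2l.
    by rewrite mulr_ge0 ?ler0n// divr_ge0// ltW.
  by rewrite exprMn ler_wpM2r ?sqr_ge0// expr2 ler_piMr//; lra.
have -> : c * (n * ((1 - lam) * d)) = (1 - lam) * c * (n * d) by ring.
lra.
Qed.

(** A single step makes the Lipschitz constants uniform at cost 2 sum D_i^2; the uniform case adds
    at most (2/lam) sum D_i^2 by Cauchy-Schwarz. *)
Lemma statE_exp D g : coord_lip D g ->
  statE (fun x => expR (g x)) <= expR (statE g + 4 / lam * \sum_i D i ^+ 2).
Proof.
move=> gD; have /andP[l0 l1] := lam01.
rewrite -pi_step; apply: (@le_trans _ _ (statE (fun x =>
  expR (2 * \sum_i D i ^+ 2) * expR (step g x)))).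
  by apply: le_statE => x; rewrite -expRD addrC; apply: step_exp.
rewrite statEZ; apply: le_trans (ler_wpM2l (expR_ge0 _) (statE_exp_uniform (coord_lip_step gD))) _.
rewrite -expRD ler_expR pi_step.
have := mean_lip_sqr D; set s := \sum_i _; set m := #|I|%:R * _ => ms.
have m0 : 0 <= m by rewrite mulr_ge0 ?ler0n ?sqr_ge0.
have -> : 2 / lam * #|I|%:R * ((1 - lam) * mean_lip D) ^+ 2 = 2 / lam * ((1 - lam) ^+ 2 * m).
  by rewrite /m; ring.
have -> : 4 / lam * s = 2 / lam * s + 2 / lam * s by field; rewrite gt_eqF.
have h1 : (1 - lam) ^+ 2 * m <= s.
  by apply: le_trans ms; rewrite ler_piMl// expr2 mulr_ile1//; lra.
have h2 : s <= lam^-1 * s.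
  by rewrite ler_peMl ?(le_trans m0)// invf_ge1// ltW.
have h3 : 0 <= 2 / lam by rewrite divr_ge0// ltW.
have := ler_wpM2l h3 h1; lra.
Qed.

Definition consp x s : nat -> S := fun k => if k is k'.+1 then s k' else x.

(** Expectation of a path functional over n steps from [x]. The path is frozen at its final state
    after time n, which is invisible to functionals of the times 0 to n. *)
Fixpoint PE n x H : R :=
  if n is n'.+1 then step (fun y => PE n' y (fun s => H (consp x s))) x
  else H (fun=> x).

Definition pathE n H : R := statE (fun x => PE n x H).

Lemma eq_PE n x H H' : (forall s, s 0%N = x -> H s = H' s) -> PE n x H = PE n x H'.
Proof.
elim: n x H H' => [|n IH] x H H' HH; first by rewrite /= HH.
by apply: eq_bernE => y; apply: IH => s _; apply: HH.
Qed.

Lemma le_PE n x H H' : (forall s, H s <= H' s) -> PE n x H <= PE n x H'.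
Proof.
elim: n x H H' => [|n IH] x H H' HH; first exact: HH.
by apply: le_bernE => // y; apply: IH.
Qed.

Lemma PEZ n x c H : PE n x (fun s => c * H s) = c * PE n x H.
Proof.
elim: n x H => [//|n IH] x H /=.
by rewrite /step -bernEZ; apply: eq_bernE => y; rewrite IH.
Qed.

Lemma PE_cst n x c : PE n x (fun=> c) = c.
Proof.
elim: n x => [//|n IH] x /=; rewrite -[RHS](bernE_cst (q x)).
by apply: eq_bernE => y; rewrite IH.
Qed.

Lemma PE_sum n x (J : Type) (r : seq J) (P : pred J) (F : J -> (nat -> S) -> R) :
  PE n x (fun s => \sum_(j <- r | P j) F j s) = \sum_(j <- r | P j) PE n x (F j).
Proof.
elim: n x F => [//|n IH] x F /=; rewrite -bernE_sum.
by apply: eq_bernE => y; rewrite IH.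
Qed.

Lemma le_pathE n H H' : (forall s, H s <= H' s) -> pathE n H <= pathE n H'.
Proof. by move=> HH; apply: le_statE => x; apply: le_PE. Qed.

Lemma pathEZ n c H : pathE n (fun s => c * H s) = c * pathE n H.
Proof. by rewrite /pathE -statEZ; apply: eq_statE => x; rewrite PEZ. Qed.

Lemma pathE_sum n (J : Type) (r : seq J) (P : pred J) (F : J -> (nat -> S) -> R) :
  pathE n (fun s => \sum_(j <- r | P j) F j s) = \sum_(j <- r | P j) pathE n (F j).
Proof. by rewrite /pathE -statE_sum; apply: eq_statE => x; rewrite PE_sum. Qed.

Lemma pathED n H H' : pathE n (fun s => H s + H' s) = pathE n H + pathE n H'.
Proof.
rewrite /pathE -statED; apply: eq_statE => x.
elim: n x H H' => [//|n IH] x H H' /=; rewrite -bernED.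
by apply: eq_bernE => y; rewrite IH.
Qed.

Lemma pathE_at n k f : (k <= n)%N -> pathE n (fun s => f (s k)) = statE f.
Proof.
elim: k n f => [|k IH] [|n] f // kn; rewrite /pathE.
- apply: eq_statE => x; rewrite -[RHS](PE_cst n.+1 x).
  by apply: eq_PE => s ->.
- rewrite -(IH n f kn) -[RHS]pi_step; apply: eq_statE => x /=.
  by apply: eq_bernE => y; apply: eq_PE.
Qed.

(** * Exponential moments of additive functionals *)

Section AdditiveFunctional.
Variables (phi : S -> S -> R) (u w : I -> R).
Hypothesis phi_lip : forall x, coord_lip u (phi x).

Definition cond_mean x := bernE (q x) (phi x).

Hypothesis cond_mean_lip : coord_lip w cond_mean.

(** The expected sum of the next n terms from a given state: the part of the exponent that a
    backward induction carries from step to step. *)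
Fixpoint future n : S -> R :=
  if n is n'.+1 then fun x => cond_mean x + step (future n') x else fun=> 0.

Let dfut i := w i + mean_lip w / lam.

(** The bound does not depend on n: all terms after the first have uniform constants forming a
    geometric series, and (1 - lam)(m + m/lam) <= m/lam with m = [mean_lip w] closes the
    induction. *)
Lemma coord_lip_future n : coord_lip dfut (future n).
Proof.
have /andP[l0 l1] := lam01.
have m0 := mean_lip_ge0 cond_mean_lip.
elim: n => [|n IH] x i b /=.
  by rewrite subrr normr0 addr_ge0 ?(lip_ge0 i cond_mean_lip)// divr_ge0// ltW.
have -> : cond_mean (upd x i b) + step (future n) (upd x i b) - (cond_mean x + step (future n) x)
  = (cond_mean (upd x i b) - cond_mean x) + (step (future n) (upd x i b) - step (future n) x) by ring.
apply: le_trans (ler_normD _ _) _; apply: lerD; first exact: cond_mean_lip.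
apply: le_trans (coord_lip_step IH x i b) _.
have -> : mean_lip dfut = mean_lip w + mean_lip w / lam.
  rewrite {1}/mean_lip big_split/= mulrDl; congr (_ + _).
  exact: (mean_lip_cst (mean_lip w / lam)).
have -> : (1 - lam) * (mean_lip w + mean_lip w / lam) = mean_lip w / lam - lam * mean_lip w.
  by field; rewrite gt_eqF.
by rewrite gerBl mulr_ge0// ltW.
Qed.

Definition path_sum n s : R := \sum_(0 <= k < n) phi (s k) (s k.+1).

(** Variance proxy of one time step: the new state y acts directly through [phi x y] (constants [u])
    and on everything later through [future n y] (constants [dfut]). *)
Definition lip_budget : R := \sum_i (u i + w i + mean_lip w / lam) ^+ 2.

(** Backward induction: the exponent left after the first step is [phi x y + future n y], its
    conditional mean is [future n.+1 x], and [bernE_exp] bounds the fluctuation of y by twice the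
    budget. *)
Lemma PE_exp_additive n x :
  PE n x (fun s => expR (path_sum n s)) <= expR (future n x + 2 * n%:R * lip_budget).
Proof.
elim: n x => [|n IH] x /=; first by rewrite /path_sum big_nil mulr0 mul0r addr0.
pose c := 2 * n%:R * lip_budget.
apply: (@le_trans _ _ (step (fun y => expR c * expR (phi x y + future n y)) x)).
  apply: le_bernE => // y; rewrite -expRD.
  have -> : PE n y (fun s => expR (path_sum n.+1 (consp x s))) =
            PE n y (fun s => expR (phi x y) * expR (path_sum n s)).
    apply: eq_PE => s sy; rewrite /path_sum big_nat_recl//= sy expRD; congr (_ * _).
  rewrite PEZ; apply: le_trans (ler_wpM2l (expR_ge0 _) (IH y)) _.
  by rewrite -expRD ler_expR /c; lra.
rewrite /step bernEZ.
have L : coord_lip (fun i => u i + w i + mean_lip w / lam) (fun y => phi x y + future n y).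
  move=> y i b; rewrite opprD addrACA -[leRHS]addrA; apply: le_trans (ler_normD _ _) _.
  by apply: lerD; [exact: phi_lip|exact: coord_lip_future].
apply: le_trans (ler_wpM2l (expR_ge0 _) (bernE_exp (q01 x) L)) _.
rewrite -expRD ler_expR bernED /c -/lip_budget.
rewrite -[n.+1%:R]natr1 /cond_mean /step; lra.
Qed.

Lemma statE_future n : statE (future n) = n%:R * statE cond_mean.
Proof.
elim: n => [|n IH] /=; first by rewrite statE_cst mul0r.
by rewrite statED pi_step IH -natr1; ring.
Qed.

Lemma pathE_exp_additive n : (0 < n)%N ->
  pathE n (fun s => expR (path_sum n s)) <=
  expR (n%:R * statE cond_mean + 6 / lam * n%:R * lip_budget).
Proof.
move=> n1; have /andP[l0 l1] := lam01.
apply: (@le_trans _ _ (statE (fun x => expR (2 * n%:R * lip_budget) * expR (future n x)))).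
  by apply: le_statE => x; rewrite -expRD addrC; apply: PE_exp_additive.
rewrite statEZ; apply: le_trans (ler_wpM2l (expR_ge0 _) (statE_exp (@coord_lip_future n))) _.
rewrite -expRD ler_expR statE_future.
have V0 : 0 <= lip_budget by apply: sumr_ge0 => i _; exact: sqr_ge0.
have DV : \sum_i dfut i ^+ 2 <= lip_budget.
  apply: ler_sum => i _; rewrite ler_sqr ?nnegrE.
  - by rewrite /dfut -addrA ler_wpDl// (lip_ge0 i (phi_lip [ffun=> true])).
  - exact: lip_ge0 (@coord_lip_future 0).
  - rewrite -addrA; apply: addr_ge0; last exact: lip_ge0 (@coord_lip_future 0).
    exact: lip_ge0 (phi_lip [ffun=> true]).
have n1R : 1 <= n%:R :> R by rewrite ler1n.
have nV : lip_budget <= n%:R * lip_budget by rewrite ler_peMl.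
have lV : n%:R * lip_budget <= lam^-1 * (n%:R * lip_budget).
  by rewrite ler_peMl ?mulr_ge0// ?(le_trans ler01)// invf_ge1// ltW.
have h4 : 0 <= 4 / lam by rewrite divr_ge0// ltW.
have := ler_wpM2l h4 DV; have := ler_wpM2l h4 nV; lra.
Qed.

End AdditiveFunctional.

Lemma additive_tail phi u w (V z : R) n : (0 < n)%N -> 0 < z -> 0 < V ->
  (forall x, coord_lip u (phi x)) -> coord_lip w (cond_mean phi) ->
  lip_budget u w <= V ->
  pathE n (fun s => (n%:R * z <= path_sum phi n s - n%:R * statE (cond_mean phi))%R%:R)
  <= expR (- (lam * z ^+ 2 * n%:R / (24 * V))).
Proof.
move=> n1 z0 V0 pl wl VV; have /andP[l0 l1] := lam01.
(* Chernoff parameter: the minimizer of - t n z + (6/lam) n t^2 V. *)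
pose t := lam * z / (12 * V).
have t0 : 0 < t by rewrite /t divr_gt0 ?mulr_gt0.
pose psi x y := t * phi x y.
have cm x : cond_mean psi x = t * cond_mean phi x by rewrite /cond_mean bernEZ.
have pl' x : coord_lip (fun i => t * u i) (psi x).
  by move=> y i b; rewrite /psi -mulrBr normrM gtr0_norm// ler_pM2l//; exact: pl.
have wl' : coord_lip (fun i => t * w i) (cond_mean psi).
  by move=> y i b; rewrite !cm -mulrBr normrM gtr0_norm// ler_pM2l//; exact: wl.
have B := pathE_exp_additive pl' wl' n1.
set mu := statE _.
apply: (@le_trans _ _ (pathE n (fun s => expR (- t * (n%:R * (z + mu))) * expR (path_sum psi n s)))).
  apply: le_pathE => s; rewrite -expRD /=.
  have -> : path_sum psi n s = t * path_sum phi n s by rewrite /path_sum mulr_sumr.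
  case: (boolP (n%:R * z <= _)) => [h|_]; last by rewrite /= ?mulr0n expR_ge0.
  rewrite /= ?mulr1n -[leLHS]expR0 ler_expR; have := ler_wpM2l (ltW t0) h; rewrite mulrBr; lra.
rewrite pathEZ; apply: le_trans (ler_wpM2l (expR_ge0 _) B) _.
rewrite -expRD ler_expR (eq_statE cm) statEZ -/mu.
have -> : lip_budget (fun i => t * u i) (fun i => t * w i) = t ^+ 2 * lip_budget u w.
  rewrite /lip_budget mulr_sumr; apply: eq_bigr => i _.
  by rewrite /mean_lip -mulr_sumr; ring.
have n1R : 0 < n%:R :> R by rewrite ltr0n.
have : 6 / lam * n%:R * (t ^+ 2 * lip_budget u w) <= 6 / lam * n%:R * (t ^+ 2 * V).
  by rewrite ler_pM2l ?mulr_gt0 ?invr_gt0// ler_pM2l ?exprn_gt0.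
move=> h; have E : - t * (n%:R * (z + mu)) + n%:R * (t * mu) + 6 / lam * n%:R * (t ^+ 2 * V)
   = - (lam * z ^+ 2 * n%:R / (24 * V)).
  by rewrite /t; field; rewrite !gt_eqF.
lra.
Qed.

Lemma additive_dev phi u w (V z : R) n : (0 < n)%N -> 0 < z -> 0 < V ->
  (forall x, coord_lip u (phi x)) -> coord_lip w (cond_mean phi) ->
  lip_budget u w <= V ->
  pathE n (fun s => (n%:R * z <= `|path_sum phi n s - n%:R * statE (cond_mean phi)|)%R%:R)
  <= 2 * expR (- (lam * z ^+ 2 * n%:R / (24 * V))).
Proof.
move=> n1 z0 V0 pl wl VV.
have cm x : cond_mean (fun x y => - phi x y) x = - cond_mean phi x.
  by rewrite /cond_mean -mulN1r -bernEZ; apply: eq_bernE => y; rewrite mulN1r.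
have h1 := additive_tail n1 z0 V0 pl wl VV.
have pl' x : coord_lip u (fun y => - phi x y).
  by move=> y i b; rewrite -opprD normrN; exact: pl.
have wl' : coord_lip w (cond_mean (fun x y => - phi x y)).
  by move=> y i b; rewrite !cm -opprD normrN; exact: wl.
have h2 := additive_tail n1 z0 V0 pl' wl' VV.
rewrite [leRHS]mulr_natl mulr2n; apply: le_trans (lerD h1 h2).
rewrite -pathED; apply: le_pathE => s.
rewrite (eq_statE cm); set mu := statE (cond_mean phi).
have -> : statE (fun x => - cond_mean phi x) = - mu.
  by rewrite -mulN1r -statEZ; apply: eq_statE => y; rewrite mulN1r.
have -> : path_sum (fun x y => - phi x y) n s = - path_sum phi n s by rewrite /path_sum sumrN.
rewrite ler_normr mulrN -opprD.
by case: (_ <= _ - _); case: (_ <= - _) => //=; rewrite ?addr0 ?add0r// lerDl.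
Qed.

Lemma stationary_dev g D (V z : R) : 0 < z -> 0 < V -> coord_lip D g ->
  \sum_i D i ^+ 2 <= V -> statE g = 0 ->
  statE (fun x => (z <= `|g x|)%R%:R) <= 2 * expR (- (lam * z ^+ 2 / (16 * V))).
Proof.
move=> z0 V0 gD DV g0; have /andP[l0 l1] := lam01.
(* The minimizer of - t z + (4/lam) t^2 V. *)
pose t := lam * z / (8 * V).
have t0 : 0 < t by rewrite /t divr_gt0 ?mulr_gt0.
have T (e : R) : `|e| = 1 -> statE (fun x => expR (t * (e * g x))) <= expR (4 / lam * (t ^+ 2 * V)).
  move=> e1; have L : coord_lip (fun i => t * D i) (fun x => t * (e * g x)).
    by move=> x i b; rewrite -!mulrBr normrM [`|e * _|]normrM e1 mul1r (gtr0_norm t0) ler_pM2l//; exact: gD.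
  apply: le_trans (statE_exp L) _; rewrite ler_expR !statEZ g0 !mulr0 add0r.
  rewrite ler_pM2l ?divr_gt0//.
  have -> : \sum_i (t * D i) ^+ 2 = t ^+ 2 * \sum_i D i ^+ 2.
    by rewrite mulr_sumr; apply: eq_bigr => i _; rewrite exprMn.
  by rewrite ler_pM2l ?exprn_gt0.
apply: (@le_trans _ _ (statE (fun x => expR (- (t * z)) * expR (t * (1 * g x)) +
                                      expR (- (t * z)) * expR (t * (-1 * g x))))).
  apply: le_statE => x; rewrite -!expRD ler_normr mul1r mulN1r.
  have := expR_ge0 (- (t * z) + t * g x); have := expR_ge0 (- (t * z) + t * - g x).
  case: (boolP (z <= g x)) => [h _ _|_] /=; [|case: (boolP (z <= - g x)) => [h _ _|_] /=].
  - rewrite -[leLHS]addr0; apply: lerD (expR_ge0 _).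
    by rewrite /= ?mulr1n -[leLHS]expR0 ler_expR -mulrN -mulrDr mulr_ge0 ?(ltW t0)//; lra.
  - rewrite -[leLHS]add0r; apply: lerD; first exact: expR_ge0.
    by rewrite /= ?mulr1n -[leLHS]expR0 ler_expR -mulrN -mulrDr mulr_ge0 ?(ltW t0)//; lra.
  - by move=> ? ?; rewrite /= ?mulr0n; apply: addr_ge0.
rewrite statED !statEZ -mulrDr.
have E1 : - (t * z) + 4 / lam * (t ^+ 2 * V) = - (lam * z ^+ 2 / (16 * V)).
  by rewrite /t; field; rewrite !gt_eqF.
rewrite -E1 expRD [leRHS]mulrCA; apply: ler_wpM2l; first exact: expR_ge0.
by rewrite [leRHS]mulr_natl mulr2n; apply: lerD; apply: T; rewrite ?normrN normr1.
Qed.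

End Chain.

(** * Truncation *)

Definition clamp (R : realType) (B z : R) : R :=
  if z < - B then - B else if B < z then B else z.

Lemma clamp_lip (R : realType) (B y z : R) : 0 <= B ->
  `|clamp B y - clamp B z| <= `|y - z|.
Proof.
move=> B0; rewrite /clamp; move: (ler_norm (y - z)) (ler_norm (z - y)).
rewrite (distrC z y) => h1 h2; rewrite ler_norml.
move: h1 h2; set n := `|y - z| => h1 h2.
case: (ltP y (- B)) => ?; case: (ltP z (- B)) => ?;
  case: (ltP B y) => ?; case: (ltP B z) => ?; apply/andP; split; lra.
Qed.

Lemma clamp_norm (R : realType) (B z : R) : 0 <= B -> `|clamp B z| <= B.
Proof.
rewrite /clamp => B0; rewrite ler_norml.
by case: (ltP z (- B)) => ?; case: (ltP B z) => ?; apply/andP; split; lra.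
Qed.

Lemma clamp_id (R : realType) (B z : R) : `|z| < B -> clamp B z = z.
Proof.
rewrite /clamp ltr_norml => /andP[h1 h2].
by case: (ltP z (- B)) => ?; case: (ltP B z) => ?; lra.
Qed.

Lemma clamp_close (R : realType) (B z : R) : 0 <= B -> `|clamp B z - z| <= `|z|.
Proof.
move=> B0; rewrite /clamp ler_norml.
move: (ler_norm z) (ler_norm (- z)); rewrite normrN; set n := `|z| => h1 h2.
by case: (ltP z (- B)) => ?; case: (ltP B z) => ?; apply/andP; split; lra.
Qed.

(** * The linear chain: covariance equation and fluctuations of the estimator *)

Section LinearChain.
Context {R : realType} {N : nat}.
Local Notation S := {ffun 'I_N -> bool}.
Variables (lam : R) (b : 'I_N -> R) (A : 'I_N -> 'I_N -> R) (pi : S -> R).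
Hypothesis lam01 : 0 < lam < 1.
Hypothesis N0 : (0 < N)%N.
Hypothesis A_small : forall i j, `|A i j| <= (1 - lam) / N%:R.

Definition lin_prob (x : S) (i : 'I_N) : R := b i + \sum_j A i j * (x j)%:R.

Local Notation q := lin_prob.
Hypothesis q01 : forall x i, 0 <= q x i <= 1.
Hypothesis pi_ge0 : forall x, 0 <= pi x.
Hypothesis pi_sum1 : \sum_x pi x = 1.
Hypothesis pi_step : forall f, statE pi (step q f) = statE pi f.

Local Notation E := (statE pi).

Definition stat_mean (i : 'I_N) : R := E (fun x => (x i)%:R).

Local Notation m := stat_mean.

Definition dev (x : S) (i : 'I_N) : R := (x i)%:R - m i.

Definition cov (i j : 'I_N) : R := E (fun x => dev x i * dev x j).

Definition ACA (i j : 'I_N) : R := \sum_k A i k * \sum_l cov k l * A j l.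

Definition colsum (j : 'I_N) : R := \sum_i A i j.

(** The conditional mean of [tot_dev] one step after [x], as [bernE_tot_dev] shows. *)
Definition lin_dev (x : S) : R := \sum_j colsum j * dev x j.

Definition tot_dev (x : S) : R := \sum_i dev x i.

Lemma lin_prob_lip (x : S) i j c :
  `|q (upd x j c) i - q x i| <= (1 - lam) / #|'I_N|%:R.
Proof.
rewrite card_ord /lin_prob opprD addrACA subrr add0r -sumrB (bigD1 j)//= big1 => [|k /negPf kj].
  rewrite addr0 -mulrBr normrM; apply: le_trans (A_small i j).
  by rewrite ler_piMr// updE eqxx; case: c (x j) => [] [] /=;
    rewrite ?subrr ?subr0 ?sub0r ?normrN ?normr0 ?normr1.
by rewrite updE kj subrr.
Qed.

Lemma stat_mean01 i : 0 <= m i <= 1.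
Proof.
apply/andP; split.
  by rewrite /m /statE sumr_ge0// => x _; rewrite mulr_ge0.
rewrite -[leRHS](statE_cst pi_sum1); apply: le_statE => // x.
by case: (x i).
Qed.

Lemma dev_le1 x i : `|dev x i| <= 1.
Proof.
have /andP[m0 m1] := stat_mean01 i.
by rewrite /dev ler_norml; case: (x i) => /=; apply/andP; split; lra.
Qed.

Lemma stat_mean_fixpoint i : m i = b i + \sum_j A i j * m j.
Proof.
rewrite /m -pi_step; under [in LHS]eq_statE do rewrite /step bernE_coord /lin_prob.
rewrite statED (statE_cst pi_sum1) statE_sum; congr (_ + _).
by apply: eq_bigr => j _; rewrite statEZ.
Qed.

Lemma lin_prob_dev x i : q x i - m i = \sum_j A i j * dev x j.
Proof.
rewrite stat_mean_fixpoint /lin_prob opprD addrACA subrr add0r -sumrB.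
by apply: eq_bigr => j _; rewrite -mulrBr.
Qed.

Lemma statE_dev i : E (fun x => dev x i) = 0.
Proof. by rewrite /dev statED (statE_cst pi_sum1) subrr. Qed.

Lemma step_dev x i : step q (fun y => dev y i) x = \sum_j A i j * dev x j.
Proof. by rewrite /step /dev bernED bernE_coord bernE_cst lin_prob_dev. Qed.

Lemma statE_bilin (f g : 'I_N -> R) :
  E (fun x => (\sum_k f k * dev x k) * (\sum_l g l * dev x l)) =
  \sum_k f k * \sum_l cov k l * g l.
Proof.
transitivity (E (fun x => \sum_k f k * \sum_l g l * (dev x k * dev x l))).
  apply: eq_statE => x; rewrite mulr_suml; apply: eq_bigr => k _.
  rewrite -mulrA; congr (_ * _); rewrite mulr_sumr; apply: eq_bigr => l _; ring.
rewrite statE_sum; apply: eq_bigr => k _; rewrite statEZ statE_sum.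
by congr (_ * _); apply: eq_bigr => l _; rewrite statEZ mulrC.
Qed.

(** Given the previous state, distinct coordinates are independent, so only their conditional means,
    linear in [dev], contribute. On the diagonal the Bernoulli noise adds a variance, hence the
    separate [cov_diag]. *)
Lemma cov_offdiag i j : i != j -> cov i j = ACA i j.
Proof.
move=> ij; rewrite /ACA -(statE_bilin (A i) (A j)) {1}/cov -pi_step; apply: eq_statE => x.
rewrite -!lin_prob_dev /step.
have -> : bernE (q x) (fun y => dev y i * dev y j) =
    bernE (q x) (fun y => (y i)%:R * dev y j + - m i * dev y j).
  by apply: eq_bernE => y; rewrite {1}/dev; ring.
rewrite bernED bernEZ bernE_coordM; last first.
  by move=> y c; rewrite /dev updE eq_sym (negPf ij).
have := step_dev x j; rewrite -lin_prob_dev /step => ->; ring.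
Qed.

Lemma cov_diag j : cov j j = m j * (1 - m j).
Proof.
transitivity (E (fun x => (1 - 2 * m j) * (x j)%:R + m j ^+ 2)).
  by apply: eq_statE => x; rewrite /dev; case: (x j) => /=; ring.
by rewrite statED statEZ (statE_cst pi_sum1) -/(m j); ring.
Qed.

Lemma exists_argmax (F : 'I_N -> R) : exists i0, forall i, F i <= F i0.
Proof.
case: (arg_maxP F (erefl true : (fun=> true) (Ordinal N0))) => i0 _ H.
by exists i0 => i; apply: H.
Qed.

Lemma sum_A_le (F : 'I_N -> R) (M : R) i : 0 <= M -> (forall j, `|F j| <= M) ->
  \sum_j `|A i j| * `|F j| <= (1 - lam) * M.
Proof.
move=> M0 FM; have NR : 0 < N%:R :> R by rewrite ltr0n.
apply: (@le_trans _ _ (\sum_(j < N) (1 - lam) / N%:R * M)).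
  by apply: ler_sum => j _; apply: ler_pM.
rewrite sumr_const card_ord -[_ *+ N]mulr_natr.
have -> : (1 - lam) / N%:R * M * N%:R = (1 - lam) * M by field; rewrite gt_eqF.
by [].
Qed.

(** For the row with the largest sum s, the diagonal contributes at most 1 and each off-diagonal
    entry at most (1 - lam)^2 s / N, so s <= 1 + (1 - lam)^2 s. *)
Lemma cov_row_sum j : \sum_i `|cov j i| <= lam^-1.
Proof.
have /andP[l0 l1] := lam01.
have NR : 0 < N%:R :> R by rewrite ltr0n.
have [j0 H] := exists_argmax (fun j => \sum_i `|cov j i|).
apply: le_trans (H j) _; set s := \sum_i _ in H *.
have s0 : 0 <= s by apply: sumr_ge0.
have V1 : `|cov j0 j0| <= 1.
  rewrite cov_diag; have /andP[m0 m1] := stat_mean01 j0.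
  by rewrite ger0_norm ?mulr_ge0 ?mulr_ile1//; lra.
have W i : `|ACA j0 i| <= (1 - lam) / N%:R * ((1 - lam) * s).
  apply: le_trans (ler_norm_sum _ _ _) _.
  apply: (@le_trans _ _ (\sum_k `|A j0 k| * `| (1 - lam) / N%:R * s|)).
    apply: ler_sum => k _; rewrite normrM ler_wpM2l//.
    apply: le_trans (ler_norm_sum _ _ _) _.
    rewrite ger0_norm ?mulr_ge0 ?divr_ge0 ?subr_ge0 ?ler0n ?(ltW l1)//.
    apply: (@le_trans _ _ (\sum_l (1 - lam) / N%:R * `|cov k l|)).
      by apply: ler_sum => l _; rewrite normrM mulrC ler_wpM2r.
    by rewrite -mulr_sumr ler_wpM2l ?divr_ge0 ?subr_ge0 ?ler0n ?(ltW l1).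
  have -> : (1 - lam) / N%:R * ((1 - lam) * s) = (1 - lam) * ((1 - lam) / N%:R * s) by ring.
  have c0 : 0 <= (1 - lam) / N%:R * s.
    by rewrite mulr_ge0 ?divr_ge0 ?subr_ge0 ?ler0n ?(ltW l1).
  by apply: sum_A_le => // _; rewrite ger0_norm.
have : s <= 1 + (1 - lam) * ((1 - lam) * s).
  rewrite {1}/s (bigD1 j0)//=; apply: lerD => //.
  apply: (@le_trans _ _ (\sum_(i < N) (1 - lam) / N%:R * ((1 - lam) * s))); last first.
    rewrite sumr_const card_ord -[_ *+ N]mulr_natr le_eqVlt; apply/orP; left; apply/eqP.
    by field; rewrite gt_eqF.
  rewrite big_mkcond; apply: ler_sum => i _; case: ifP => [ij|_].
    by rewrite cov_offdiag 1?eq_sym.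
  by rewrite !mulr_ge0 ?invr_ge0 ?ler0n ?subr_ge0 ?(ltW l1).
move=> h; rewrite -(ler_pM2l l0) divff ?gt_eqF//.
have : lam * lam * s <= lam * s by rewrite ler_wpM2r// ler_piMl// ltW.
nra.
Qed.

Lemma colsum_le1 j : `|colsum j| <= 1.
Proof.
have /andP[l0 l1] := lam01.
apply: le_trans (ler_norm_sum _ _ _) _.
apply: (@le_trans _ _ (\sum_(i < N) (1 - lam) / N%:R)); first exact: ler_sum.
rewrite sumr_const card_ord -[_ *+ N]mulr_natr mulfVK ?pnatr_eq0 -?lt0n//.
lra.
Qed.

Lemma bernE_tot_dev x : bernE (q x) tot_dev = lin_dev x.
Proof.
rewrite /tot_dev bernE_sum /lin_dev /colsum.
transitivity (\sum_i \sum_j A i j * dev x j).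
  by apply: eq_bigr => i _; rewrite -step_dev.
by rewrite exchange_big; apply: eq_bigr => j _; rewrite mulr_suml.
Qed.

Lemma dev_upd x i c j : dev (upd x i c) j - dev x j =
  if j == i then c%:R - (x i)%:R else 0.
Proof.
by rewrite /dev opprB addrA subrK updE; case: eqP => [->//|_]; rewrite subrr.
Qed.

Lemma bool_diff_le1 (c d : bool) : `|c%:R - d%:R| <= 1 :> R.
Proof. by case: c d => [] []; rewrite /= ?subrr ?subr0 ?sub0r ?normrN ?normr0 ?normr1. Qed.

Lemma wsum_dev_lip (f : 'I_N -> R) x i c : (forall j, `|f j| <= 1) ->
  `|\sum_j f j * dev (upd x i c) j - \sum_j f j * dev x j| <= 1.
Proof.
move=> f1; rewrite -sumrB (bigD1 i)//= big1 => [|k /negPf kj].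
  by rewrite -mulrBr dev_upd eqxx addr0 normrM mulr_ile1// bool_diff_le1.
by rewrite -mulrBr dev_upd kj mulr0.
Qed.

Lemma lin_dev_lip : coord_lip (fun=> 1) lin_dev.
Proof. by move=> x i c; apply: wsum_dev_lip => j; exact: colsum_le1. Qed.

Lemma tot_dev_lip : coord_lip (fun=> 1) tot_dev.
Proof.
move=> x i c; have E1 y : tot_dev y = \sum_j 1 * dev y j.
  by apply: eq_bigr => j _; rewrite mul1r.
by rewrite !E1; apply: wsum_dev_lip => j; rewrite normr1.
Qed.

Lemma lin_dev_le x : `|lin_dev x| <= N%:R.
Proof.
apply: le_trans (ler_norm_sum _ _ _) _.
rewrite -[N in N%:R]card_ord -sum1_card natr_sum; apply: ler_sum => j _.
by rewrite normrM mulr_ile1// ?colsum_le1 ?dev_le1.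
Qed.

Lemma statE_lin_dev : E lin_dev = 0.
Proof.
by rewrite /lin_dev statE_sum big1// => j _; rewrite statEZ statE_dev mulr0.
Qed.

(** Only the conditional mean is clamped; the innovation [tot_dev y - lin_dev x] stays intact. The
    dependence on y is thus still 1-Lipschitz, and the conditional mean is exactly
    [clamp B (lin_dev x) * dev x j], with constant 1 + B instead of order N in coordinate [j]. *)
Definition cross (B : R) (j : 'I_N) (x y : S) : R :=
  (tot_dev y - lin_dev x + clamp B (lin_dev x)) * dev x j.

Lemma cross_lip B j x : coord_lip (fun=> 1) (cross B j x).
Proof.
move=> y i c; rewrite /cross -mulrBl normrM mulr_ile1 ?dev_le1//.
set c0 := clamp _ _; set l := lin_dev x.
have -> : tot_dev (upd y i c) - l + c0 - (tot_dev y - l + c0) = tot_dev (upd y i c) - tot_dev y by ring.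
exact: tot_dev_lip.
Qed.

Lemma cond_mean_cross B j x :
  cond_mean q (cross B j) x = clamp B (lin_dev x) * dev x j.
Proof.
rewrite /cond_mean /cross.
transitivity (bernE (q x) (fun y => dev x j * (tot_dev y + (clamp B (lin_dev x) - lin_dev x)))).
  by apply: eq_bernE => y; ring.
by rewrite bernEZ bernED bernE_cst bernE_tot_dev; ring.
Qed.

Lemma cond_mean_cross_lip B j : 0 <= B ->
  coord_lip (fun i => 1 + (i == j)%:R * B) (cond_mean q (cross B j)).
Proof.
move=> B0 x i c; rewrite !cond_mean_cross.
set y := upd x i c; set f := clamp B.
have -> : f (lin_dev y) * dev y j - f (lin_dev x) * dev x j =
  (f (lin_dev y) - f (lin_dev x)) * dev y j + f (lin_dev x) * (dev y j - dev x j) by ring.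
apply: le_trans (ler_normD _ _) _; apply: lerD; rewrite normrM.
  rewrite mulr_ile1 ?dev_le1//; apply: le_trans (clamp_lip _ _ B0) _; exact: lin_dev_lip.
rewrite dev_upd [j == i]eq_sym; case: (i == j); last by rewrite normr0 mulr0 mul0r.
by rewrite mulrC ler_pM// ?bool_diff_le1// clamp_norm.
Qed.

(** Truncation acts only where |lin_dev| >= B, and there it changes the value by at most |lin_dev|
    <= N. *)
Lemma cross_bias B j : 0 <= B ->
  `|E (cond_mean q (cross B j)) - \sum_i cov j i * colsum i| <=
  N%:R * E (fun x => (B <= `|lin_dev x|)%R%:R).
Proof.
move=> B0.
have -> : \sum_i cov j i * colsum i = E (fun x => lin_dev x * dev x j).
  transitivity (E (fun x => \sum_i colsum i * (dev x j * dev x i))).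
    by rewrite statE_sum; apply: eq_bigr => i _; rewrite statEZ mulrC.
  by apply: eq_statE => x; rewrite mulr_suml; apply: eq_bigr => i _; ring.
rewrite /statE -sumrB mulr_sumr; apply: le_trans (ler_norm_sum _ _ _) _.
apply: ler_sum => x _; rewrite cond_mean_cross -mulrBr -mulrBl !normrM.
rewrite (ger0_norm (pi_ge0 x)) [leRHS]mulrCA ler_wpM2l//.
case: (leP B `|lin_dev x|) => h; last by rewrite clamp_id// subrr normr0 mul0r mulr0.
rewrite mulr1 -[leRHS]mulr1 ler_pM ?dev_le1//.
by apply: le_trans (clamp_close _ B0) _; exact: lin_dev_le.
Qed.

(** Sample times start at 1 and path times at 0; the estimators sum from t = 1, so the value at t =
    0 is never read. *)
Definition path_sample (s : nat -> S) (t : nat) : 'cV[R]_N :=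
  \col_i (s t.-1 i)%:R.

Lemma mean_hat_path s T i : (0 < T)%N ->
  mean_hat (path_sample s) T i 0 = m i + T%:R^-1 * \sum_(0 <= k < T) dev (s k) i.
Proof.
move=> T0; rewrite /mean_hat mxE summxE big_add1 /=.
under eq_bigr => k _ do rewrite mxE /=.
rewrite /dev big_split/= sumr_const_nat subn0 mulrDr mulNrn mulrN.
by rewrite -[m i *+ T]mulr_natl mulrA mulVf ?pnatr_eq0 -?lt0n// mul1r; ring.
Qed.

(** Recentring from the empirical to the stationary mean leaves one product of averages: the shift
    [tb] of the total multiplies the sum of [dev (s k) j - db], which vanishes. *)
Lemma sigma_ag_path s T j : (0 < T)%N ->
  sigma_ag (path_sample s) T j 0 =
  T%:R^-1 * \sum_(0 <= k < T) tot_dev (s k.+1) * dev (s k) j -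
  (T%:R^-1 * \sum_(0 <= k < T) dev (s k) j) *
  (T%:R^-1 * \sum_(0 <= k < T) tot_dev (s k.+1)).
Proof.
move=> T0; set db := T%:R^-1 * \sum_(0 <= k < T) dev (s k) j.
have TR : T%:R != 0 :> R by rewrite pnatr_eq0 -lt0n.
set xs := path_sample s; set mh := mean_hat xs T.
have ES i : Sigma1_hat xs T i j = T%:R^-1 * \sum_(0 <= k < T)
    ((s k.+1 i)%:R - mh i 0) * ((s k j)%:R - mh j 0).
  rewrite /Sigma1_hat -/mh; move: mh => M; rewrite mxE summxE big_add1 /=; congr (_ * _).
  by apply: eq_bigr => k _; rewrite !mxE big_ord1 !mxE.
pose tb := \sum_i (mh i 0 - m i).
have E1 : sigma_ag xs T j 0 =
    T%:R^-1 * \sum_(0 <= k < T) (tot_dev (s k.+1) - tb) * (dev (s k) j - db).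
  rewrite /sigma_ag mxE.
  transitivity (\sum_i T%:R^-1 * \sum_(0 <= k < T)
      (dev (s k.+1) i - (mh i 0 - m i)) * (dev (s k) j - db)).
    apply: eq_bigr => i _; rewrite mxE [const_mx _ _ _]mxE mulr1 ES; congr (_ * _).
    apply: eq_bigr => k _; congr (_ * _); first by rewrite /dev; ring.
    by rewrite /mh mean_hat_path// -/db /dev; ring.
  rewrite -mulr_sumr exchange_big; congr (_ * _); apply: eq_bigr => k _ /=.
  by rewrite -mulr_suml; congr (_ * _); rewrite sumrB.
rewrite E1.
have Edb : \sum_(0 <= k < T) (dev (s k) j - db) = 0.
  rewrite sumrB sumr_const_nat subn0 -[db *+ T]mulr_natl /db mulrA divff// mul1r.
  exact: subrr.
transitivity (T%:R^-1 * (\sum_(0 <= k < T) tot_dev (s k.+1) * dev (s k) j -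
    db * \sum_(0 <= k < T) tot_dev (s k.+1) - tb * \sum_(0 <= k < T) (dev (s k) j - db))).
  congr (_ * _); rewrite !mulr_sumr -!sumrB; apply: eq_bigr => k _; ring.
by rewrite Edb; ring.
Qed.

(** Coordinate i contributes at most (3/lam + [i = j] B + c/lam)^2 with c = B/N, and (x + y + w)^2
    <= 3 (x^2 + y^2 + w^2). The three squares sum to 27 N/lam^2, 3 B^2 and 3 N c^2/lam^2, the last
    two being at most 3 B^2/lam^2 each. *)
Lemma cross_budget B j : 0 <= B ->
  lip_budget lam (fun _ : 'I_N => 1) (fun i => 1 + (i == j)%:R * B) <=
  (27 * N%:R + 6 * B ^+ 2) / lam ^+ 2.
Proof.
move=> B0; have /andP[l0 l1] := lam01.
have NR : 1 <= N%:R :> R by rewrite ler1n.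
have ml : mean_lip (fun i : 'I_N => 1 + (i == j)%:R * B) = 1 + B / N%:R.
  rewrite /mean_lip card_ord big_split/= sumr_const card_ord -mulr_suml.
  have -> : \sum_(i < N) (i == j)%:R = 1 :> R.
    by rewrite (bigD1 j)//= eqxx big1 ?addr0// => k /negPf ->.
  by rewrite mul1r mulrDl divff// gt_eqF// (lt_le_trans ltr01).
rewrite /lip_budget ml; set c := B / N%:R.
have c0 : 0 <= c by rewrite divr_ge0.
have il : 1 <= lam^-1 by rewrite invf_ge1// ltW.
have sq3 (x y w : R) : (x + y + w) ^+ 2 <= 3 * (x ^+ 2 + y ^+ 2 + w ^+ 2).
  have := sqr_ge0 (x - y); have := sqr_ge0 (x - w); have := sqr_ge0 (y - w); nra.
apply: (@le_trans _ _ (\sum_(i < N)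
   (27 / lam ^+ 2 + 3 * ((i == j)%:R * B ^+ 2) + 3 * (c ^+ 2 / lam ^+ 2)))).
  apply: ler_sum => i _.
  apply: (@le_trans _ _ ((3 / lam + (i == j)%:R * B + c / lam) ^+ 2)).
    rewrite ler_sqr ?nnegrE.
    - have -> : (1 + c) / lam = lam^-1 + c / lam by rewrite mulrDl mul1r.
      have -> : 3 / lam = lam^-1 + lam^-1 + lam^-1 by field; rewrite gt_eqF.
      lra.
    - by rewrite !addr_ge0 ?mulr_ge0 ?invr_ge0 ?ler0n ?(ltW l0)// ?addr_ge0.
    - by rewrite !addr_ge0 ?mulr_ge0 ?invr_ge0 ?ler0n ?(ltW l0).
  apply: le_trans (sq3 _ _ _) _; rewrite !expr_div_n exprMn.
  have -> : ((i == j)%:R : R) ^+ 2 = (i == j)%:R.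
    by case: (i == j); rewrite /= ?expr1n ?expr0n.
  rewrite le_eqVlt; apply/orP; left; apply/eqP; ring.
have S1 : \sum_(i < N) (i == j)%:R = 1 :> R.
  by rewrite (bigD1 j)//= eqxx big1 ?addr0// => k /negPf ->.
rewrite !big_split/= !sumr_const card_ord -mulr_sumr -mulr_suml S1 mul1r.
rewrite -[(27 / _) *+ N]mulr_natl -[(3 * (c ^+ 2 / _)) *+ N]mulr_natl.
have cN : N%:R * c ^+ 2 <= B ^+ 2.
  rewrite /c expr_div_n mulrCA ler_piMr ?sqr_ge0//.
  rewrite expr2 invfM mulrA divff ?mul1r ?invf_le1// ?gt_eqF//; exact: lt_le_trans NR.
have iB : B ^+ 2 <= B ^+ 2 / lam ^+ 2.
  by rewrite ler_peMr ?sqr_ge0// -exprVn exprn_ege1.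
have icN : N%:R * c ^+ 2 / lam ^+ 2 <= B ^+ 2 / lam ^+ 2.
  by rewrite ler_wpM2r// invr_ge0 sqr_ge0.
rewrite mulrDl; lra.
Qed.

(** Stated with the bound of [cross_budget] so that one [V] serves both functionals. *)
Lemma tot_budget B : 0 <= B ->
  lip_budget lam (fun _ : 'I_N => 1) (fun _ : 'I_N => 1) <=
  (27 * N%:R + 6 * B ^+ 2) / lam ^+ 2.
Proof.
move=> B0; have /andP[l0 l1] := lam01.
have il : 1 <= lam^-1 by rewrite invf_ge1// ltW.
have IN : (0 < #|'I_N|)%N by rewrite card_ord.
rewrite /lip_budget (mean_lip_cst IN) sumr_const card_ord -[_ *+ N]mulr_natl.
have -> : (27 * N%:R + 6 * B ^+ 2) / lam ^+ 2 = N%:R * (27 / lam ^+ 2) + 6 * B ^+ 2 / lam ^+ 2 by ring.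
rewrite -[leLHS]addr0; apply: lerD; last by rewrite !mulr_ge0 ?invr_ge0 ?sqr_ge0.
rewrite ler_wpM2l// mul1r.
have -> : 27 / lam ^+ 2 = 3 * (3 * lam^-1) ^+ 2 by field; rewrite gt_eqF.
have h : (1 + 1 + lam^-1) ^+ 2 <= (3 * lam^-1) ^+ 2 by rewrite ler_sqr ?nnegrE; lra.
by apply: le_trans h _; rewrite ler_peMl ?sqr_ge0//; lra.
Qed.

(* The truncation of lin_dev at level B is invisible on the event that
   |lin_dev| < B along the path. *)
Lemma sigma_ag_noise (B V z e1 e2 : R) T : (0 < T)%N -> 0 < z -> 0 < B -> 0 < V ->
  (27 * N%:R + 6 * B ^+ 2) / lam ^+ 2 <= V ->
  2 * expR (- (lam * z ^+ 2 * T%:R / (24 * V))) <= e1 ->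
  2 * expR (- (lam * B ^+ 2 / (16 * N%:R))) <= e2 ->
  pathE q pi T (fun s => (~~ [forall j,
    `|sigma_ag (path_sample s) T j 0 - \sum_i cov j i * colsum i|
      <= 2 * z + N%:R * e2])%:R) <= N.+1%:R * e1 + T%:R * e2.
Proof.
move=> T0 z0 B0 V0 hV he1 he2; have /andP[l0 l1] := lam01.
have IN : (0 < #|'I_N|)%N by rewrite card_ord.
have NR : 0 < N%:R :> R by rewrite ltr0n.
have TR : 0 < T%:R :> R by rewrite ltr0n.
have B0' := ltW B0.
pose phi (x : S) (y : S) := tot_dev y.
have phi_lip x : coord_lip (fun=> 1) (phi x) by exact: tot_dev_lip.
have cm_phi : cond_mean q phi =1 lin_dev by move=> x; exact: bernE_tot_dev.
have cm_lip : coord_lip (fun=> 1) (cond_mean q phi).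
  by move=> x i c; rewrite !cm_phi; exact: lin_dev_lip.
have D1 := additive_dev lam01 IN q01 lin_prob_lip pi_ge0 pi_sum1 pi_step T0 z0 V0
  phi_lip cm_lip (le_trans (tot_budget B0') hV).
have D2 j := additive_dev lam01 IN q01 lin_prob_lip pi_ge0 pi_sum1 pi_step T0 z0 V0
  (cross_lip B j) (cond_mean_cross_lip j B0') (le_trans (cross_budget j B0') hV).
have D3 : E (fun x => (B <= `|lin_dev x|)%R%:R) <= e2.
  apply: le_trans he2; apply: (stationary_dev lam01 IN q01 lin_prob_lip pi_ge0 pi_sum1 pi_step B0 NR lin_dev_lip _ statE_lin_dev).
  by rewrite expr1n sumr_const card_ord.
rewrite (eq_statE _ cm_phi) statE_lin_dev mulr0 in D1.
(* Union bound: one event for the average of [tot_dev], N for the cross averages, and T for the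
   times at which the truncation is active. *)
apply: (@le_trans _ _ (pathE q pi T (fun s =>
  (T%:R * z <= `|path_sum phi T s - 0|)%R%:R +
  \sum_j (T%:R * z <= `|path_sum (cross B j) T s - T%:R * E (cond_mean q (cross B j))|)%R%:R +
  \sum_(0 <= k < T) (B <= `|lin_dev (s k)|)%R%:R))).
  apply: le_pathE => // s; rewrite subr0.
  have S2 : 0 <= \sum_j (T%:R * z <= `|path_sum (cross B j) T s - T%:R * E (cond_mean q (cross B j))|)%R%:R :> R.
    by apply: sumr_ge0.
  have S3 : 0 <= \sum_(0 <= k < T) (B <= `|lin_dev (s k)|)%R%:R :> R by apply: sumr_ge0.
  case: (boolP (T%:R * z <= `|path_sum phi T s|)) => [_|].
    by case: [forall _, _]; rewrite /= -?addrA ?lerDl addr_ge0 ?addr_ge0.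
  rewrite -ltNge add0r => G1.
  have [/existsP[j0 hj]|/existsPn G2] := boolP [exists j, T%:R * z <=
      `|path_sum (cross B j) T s - T%:R * E (cond_mean q (cross B j))|].
    apply: (@le_trans _ _ 1); first by case: [forall _, _].
    rewrite -[leLHS]addr0; apply: lerD => //; rewrite (bigD1 j0)//= hj lerDl.
    by apply: sumr_ge0.
  have [/hasP[k kT hk]|/hasPn G3] := boolP (has (fun k => B <= `|lin_dev (s k)|) (index_iota 0 T)).
    apply: (@le_trans _ _ 1); first by case: [forall _, _].
    rewrite -[leLHS]add0r; apply: lerD => //; rewrite (big_rem k)//= hk lerDl.
    by apply: sumr_ge0.
  rewrite (_ : [forall j, _]) /= ?addr_ge0//; apply/forallP => j.
  have Ec : path_sum (cross B j) T s = \sum_(0 <= k < T) tot_dev (s k.+1) * dev (s k) j.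
    apply: eq_big_nat => k kT; rewrite /cross clamp_id ?subrK//.
    by rewrite ltNge; apply: G3; rewrite mem_index_iota.
  have := G2 j; rewrite Ec -ltNge => {}G2.
  rewrite sigma_ag_path//.
  have -> : \sum_(0 <= k < T) tot_dev (s k.+1) = path_sum phi T s by [].
  set X := \sum_(0 <= k < T) tot_dev _ * _ in G2 *.
  set mu := E _ in G2; set cc := \sum_i _.
  have A1 : `|T%:R^-1 * X - mu| <= z.
    have -> : T%:R^-1 * X - mu = T%:R^-1 * (X - T%:R * mu) by field; rewrite gt_eqF.
    rewrite normrM gtr0_norm ?invr_gt0// ler_pdivrMl//; exact: ltW.
  have A2 : `|mu - cc| <= N%:R * e2.
    by apply: le_trans (cross_bias j B0') _; rewrite ler_wpM2l.
  have A3 : `|T%:R^-1 * path_sum phi T s| <= z.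
    rewrite normrM gtr0_norm ?invr_gt0// ler_pdivrMl//; exact: ltW.
  have A4 : `|T%:R^-1 * \sum_(0 <= k < T) dev (s k) j| <= 1.
    rewrite normrM gtr0_norm ?invr_gt0// ler_pdivrMl// mulr1.
    apply: le_trans (ler_norm_sum _ _ _) _.
    apply: (@le_trans _ _ (\sum_(0 <= k < T) 1)); first by apply: ler_sum => k _; exact: dev_le1.
    by rewrite sumr_const_nat subn0.
  have A5 := ler_pM (normr_ge0 _) (normr_ge0 _) A4 A3; rewrite -normrM mul1r in A5.
  (* Fluctuation z, truncation bias N e2, and a centring product whose factors are at most 1 and
     z. *)
  rewrite (_ : _ - cc = (T%:R^-1 * X - mu) + (mu - cc) -
    T%:R^-1 * (\sum_(0 <= k < T) dev (s k) j) * (T%:R^-1 * path_sum phi T s)); last by ring.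
  apply: le_trans (ler_normB _ _) _; apply: le_trans (lerD (ler_normD _ _) (lexx _)) _.
  lra.
rewrite !pathED !pathE_sum -natr1 mulrDl mul1r [N%:R * e1 + e1]addrC.
apply: lerD; first apply: lerD.
- exact: le_trans D1 he1.
- apply: (@le_trans _ _ (\sum_(j < N) e1)); first by apply: ler_sum => j _; exact: le_trans (D2 j) he1.
  by rewrite sumr_const card_ord -[leLHS]mulr_natl.
- apply: (@le_trans _ _ (\sum_(0 <= k < T) e2)).
    rewrite big_nat_cond [leRHS]big_nat_cond; apply: ler_sum => k /andP[/andP[_ kT] _].
    by rewrite (pathE_at pi_step (fun x => (B <= `|lin_dev x|)%R%:R) (ltnW kT)).
  by rewrite sumr_const_nat subn0 -[leLHS]mulr_natl.
Qed.

End LinearChain.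

(** * Deterministic perturbation analysis of the covariance equation *)

Section Perturbation.
Context {R : realType} {N : nat}.
Variables (lam : R) (A C : 'I_N -> 'I_N -> R) (b m eps : 'I_N -> R).
Variables (al rho beta0 m0 kap del : R).
Hypothesis lam01 : 0 < lam < 1.
Hypothesis N0 : (0 < N)%N.
Hypothesis A_small : forall i j, `|A i j| <= (1 - lam) / N%:R.
Hypothesis m_fix : forall i, m i = b i + \sum_j A i j * m j.
Hypothesis m01 : forall i, 0 <= m i <= 1.
Hypothesis C_off : forall i j, i != j ->
  C i j = \sum_k A i k * \sum_l C k l * A j l.
Hypothesis C_diag : forall j, C j j = m j * (1 - m j).
Hypothesis C_row : forall j, \sum_i `|C j i| <= lam^-1.
Hypothesis eps1 : forall i, `|eps i| = 1.
Hypothesis al01 : 0 <= al <= 1 - lam.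
Hypothesis rho1 : `|rho| <= 1.
Hypothesis m0_01 : 0 <= m0 <= 1.
Hypothesis m0_fix : m0 = beta0 + al * rho * m0.
Let d := m0 * (1 - m0).
Hypothesis kap_fix : kap = al * rho * (d * al + kap * (al * rho)).
Hypothesis hb : forall i, `|b i - beta0| <= del.
Hypothesis hA1 : forall i, `|\sum_j A i j - al * rho| <= 2 * del.
Hypothesis hAe : forall i, `|\sum_j A i j * eps j - al| <= 2 * del.
Hypothesis hAte : forall j, `|\sum_i A i j * eps i - al * rho * eps j| <= 2 * del.
Hypothesis hc : forall j, `|\sum_i A i j - al * eps j| <= 2 * del.
Hypothesis Ndel : 1 <= N%:R * del.

Let NR : 0 < N%:R :> R. Proof. by rewrite ltr0n. Qed.

Let l0 : 0 < lam. Proof. by case/andP: lam01. Qed.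

Let l1 : 0 <= 1 - lam. Proof. by case/andP: lam01 => ? ?; lra. Qed.

Let il1 : 1 <= lam^-1.
Proof. by rewrite invf_ge1//; case/andP: lam01 => _ /ltW. Qed.

Let del0 : 0 <= del.
Proof. by rewrite -(pmulr_rge0 _ NR) (le_trans ler01). Qed.

Let alrho : `|al * rho| <= 1 - lam.
Proof.
case/andP: al01 => a0 a1; rewrite normrM ger0_norm//.
by rewrite -[leRHS]mulr1 ler_pM.
Qed.

Lemma mulA_le (F : 'I_N -> R) (M : R) i : 0 <= M -> (forall j, `|F j| <= M) ->
  `|\sum_j A i j * F j| <= (1 - lam) * M.
Proof.
move=> M0 FM; apply: le_trans (ler_norm_sum _ _ _) _.
under eq_bigr do rewrite normrM.
exact: sum_A_le.
Qed.

Lemma mulC_le (F : 'I_N -> R) (M : R) j : 0 <= M -> (forall j, `|F j| <= M) ->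
  `|\sum_i C j i * F i| <= M / lam.
Proof.
move=> M0 FM; apply: le_trans (ler_norm_sum _ _ _) _.
apply: (@le_trans _ _ (\sum_i `|C j i| * M)).
  by apply: ler_sum => i _; rewrite normrM ler_wpM2l.
by rewrite -mulr_suml mulrC ler_wpM2l.
Qed.

(** At an index where |w| is maximal, with value M, the equation gives M <= e0 + (1 - lam) M. *)
Lemma contraction_bound (w e : 'I_N -> R) (th e0 : R) : `|th| <= 1 ->
  (forall i, w i = e i + th * \sum_j A i j * w j) -> (forall i, `|e i| <= e0) ->
  forall i, `|w i| <= e0 / lam.
Proof.
move=> th1 we ee i.
have [i0 H] := exists_argmax N0 (fun i => `|w i|).
apply: le_trans (H i) _; rewrite ler_pdivlMr//.
have := mulA_le i0 (normr_ge0 (w i0)) H.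
set M := `|w i0|; set t := \sum_j _ => h.
have tt : `|th * t| <= (1 - lam) * M.
  by rewrite normrM -[leRHS]mul1r ler_pM.
have : M <= e0 + (1 - lam) * M.
  rewrite {1}/M we; apply: le_trans (ler_normD _ _) _; exact: lerD.
lra.
Qed.

Lemma mean_close i : `|m i - m0| <= 3 * del / lam.
Proof.
apply: (@contraction_bound (fun i => m i - m0)
  (fun i => (b i - beta0) + m0 * (\sum_j A i j - al * rho)) 1) => [|k|k].
- by rewrite normr1.
- rewrite {1}m_fix mul1r.
  have -> : \sum_j A k j * (m j - m0) = \sum_j A k j * m j - m0 * \sum_j A k j.
    by rewrite mulr_sumr -sumrB; apply: eq_bigr => j _; ring.
  by rewrite {1}m0_fix; ring.
- apply: le_trans (ler_normD _ _) _; rewrite normrM.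
  have -> : 3 * del = del + 2 * del by ring.
  apply: lerD => //; case/andP: m0_01 => a0 a1.
  by rewrite ger0_norm// -[leRHS]mul1r ler_pM.
Qed.

Let t (j : 'I_N) := \sum_k A j k * \sum_l C k l * A j l.

(** Every entry of A is O(1/N) and the remaining factors are bounded, so the diagonal of A C A^T is
    O(1/N); [Ndel] converts 1/N into [del]. *)
Lemma quad_small j : `|t j| <= del / lam.
Proof.
have cN : 0 <= (1 - lam) / N%:R by rewrite divr_ge0// ltW.
have h := mulA_le j (_ : 0 <= (1 - lam) / N%:R / lam)
  (fun k => mulC_le k cN (fun l => A_small j l)).
apply: le_trans (h _) _; first by rewrite divr_ge0// ltW.
rewrite mulrA ler_pM2r ?invr_gt0// mulrA.
rewrite ler_pdivrMr// (le_trans _ (_ : 1 <= _))//; last by rewrite mulrC.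
by rewrite mulr_ile1//; case/andP: lam01 => ? ?; lra.
Qed.

(** Chosen so that C = diag D + A C A^T holds on the diagonal as well. *)
Let D j := C j j - t j.

Lemma diag_close j : `|D j - d| <= 4 * del / lam.
Proof.
have -> : D j - d = (m j - m0) * (1 - m j - m0) - t j by rewrite /D C_diag /d; ring.
apply: le_trans (ler_normB _ _) _.
have -> : 4 * del / lam = 3 * del / lam + del / lam by field; rewrite gt_eqF.
apply: lerD (quad_small j); rewrite normrM -[leRHS]mulr1; apply: ler_pM => //.
  exact: mean_close.
by case/andP: (m01 j) => ? ?; case/andP: m0_01 => ? ?; rewrite ler_norml; apply/andP; split; lra.
Qed.

Lemma C_expand j (F : 'I_N -> R) :
  \sum_i C j i * F i = D j * F j + \sum_k A j k * \sum_l C k l * \sum_i A i l * F i.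
Proof.
have E : \sum_k A j k * (\sum_l C k l * \sum_i A i l * F i) =
    \sum_i (\sum_k A j k * \sum_l C k l * A i l) * F i.
  transitivity (\sum_k \sum_i A j k * ((\sum_l C k l * A i l) * F i)).
    apply: eq_bigr => k _; rewrite -mulr_sumr.
    have -> : \sum_i (\sum_l C k l * A i l) * F i = \sum_l C k l * \sum_i A i l * F i.
      under eq_bigr => i _ do rewrite mulr_suml.
      rewrite exchange_big; apply: eq_bigr => l _; rewrite mulr_sumr.
      by apply: eq_bigr => i _; ring.
    by [].
  rewrite exchange_big; apply: eq_bigr => i _; rewrite mulr_suml.
  by apply: eq_bigr => k _; rewrite mulrA.
rewrite E (bigD1 j)//= [in RHS](bigD1 j)//= addrA -mulrDl /D /t subrK.
by congr (_ + _); apply: eq_bigr => i ij; rewrite C_off// eq_sym.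
Qed.

Let kap_le : `|kap| <= lam^-1.
Proof.
have d1 : 0 <= d <= 1.
  by case/andP: m0_01 => ? ?; rewrite /d mulr_ge0 ?mulr_ile1//=; lra.
case/andP: d1 => d0 d1; case/andP: al01 => a0 a1.
have ll : 0 < lam /\ lam < 1 by apply/andP.
have h : `|kap| <= 1 + (1 - lam) * `|kap|.
  rewrite {1}kap_fix normrM -[leRHS]mul1r; apply: ler_pM => //.
    by apply: le_trans alrho _; lra.
  apply: le_trans (ler_normD _ _) _; apply: lerD.
    by rewrite normrM !ger0_norm// mulr_ile1//; lra.
  by rewrite normrM mulrC ler_wpM2r.
by rewrite -(ler_pM2l l0) divff ?gt_eqF//; lra.
Qed.

Let u j := \sum_i C j i * eps i.

(** Up to O(del), A^T eps is al rho eps, so u = C eps nearly solves u = D eps + al rho A u. Since A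
    eps is close to al and A 1 to al rho, the ansatz d eps + const is preserved, and [kap_fix] is
    the scalar equation for the constant. The 10 collects 2 + 2 from the two row sums, 4 from
    [diag_close] and 2 from A^T eps. *)
Lemma u_close j : `|u j - (d * eps j + kap)| <= 10 * del / lam / lam.
Proof.
have ll : 0 < lam /\ lam < 1 by apply/andP.
have d1 : `|d| <= 1.
  by case/andP: m0_01 => ? ?; rewrite /d ger0_norm ?mulr_ge0 ?mulr_ile1//=; lra.
pose e1 l := \sum_i A i l * eps i - al * rho * eps l.
pose e j := (al * rho) * (d * (\sum_k A j k * eps k - al) + kap * (\sum_k A j k - al * rho))
  + (D j - d) * eps j + \sum_k A j k * \sum_l C k l * e1 l.
apply: (@contraction_bound (fun j => u j - (d * eps j + kap)) e (al * rho)) => [|i|i].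
- by apply: le_trans alrho _; lra.
- rewrite /u C_expand.
  have -> : \sum_k A i k * (\sum_l C k l * \sum_i0 A i0 l * eps i0) =
    \sum_k A i k * (\sum_l C k l * e1 l) + al * rho * \sum_k A i k * u k.
    rewrite mulr_sumr -big_split/=; apply: eq_bigr => k _.
    rewrite mulrCA -mulrDr; congr (_ * _); rewrite /u mulr_sumr -big_split/=.
    by apply: eq_bigr => l _; rewrite /e1; ring.
  have -> : \sum_j A i j * (\sum_i0 C j i0 * eps i0 - (d * eps j + kap)) =
    \sum_k A i k * u k - d * (\sum_k A i k * eps k) - kap * \sum_k A i k.
    rewrite !mulr_sumr -!sumrB; apply: eq_bigr => k _; rewrite /u; ring.
  by rewrite [X in - (_ + X)]kap_fix /e; ring.
- have -> : 10 * del / lam = 2 * del / lam + 2 * del / lam + 4 * del / lam + 2 * del / lam.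
    by field; rewrite gt_eqF.
  rewrite /e; apply: le_trans (ler_normD _ _) _; apply: lerD; last first.
    have c0 : 0 <= 2 * del / lam by rewrite divr_ge0 ?mulr_ge0// ltW.
    have del2 : 0 <= 2 * del by rewrite mulr_ge0.
    apply: le_trans (mulA_le i c0 (fun k => mulC_le k del2 hAte)) _.
    by apply: ler_piMl => //; case: ll => ? ?; lra.
  apply: le_trans (ler_normD _ _) _; apply: lerD; last first.
    by rewrite normrM eps1 mulr1 diag_close.
  rewrite normrM -[leRHS]mul1r; apply: ler_pM => //.
    by apply: le_trans alrho _; lra.
  have := il1; have := del0 => h0 h1.
  apply: le_trans (ler_normD _ _) _.
  rewrite [`|d * _|]normrM [`|kap * _|]normrM; apply: lerD.
    apply: (@le_trans _ _ (1 * (2 * del))); first by apply: ler_pM.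
    by rewrite mul1r ler_peMr// mulr_ge0.
  by rewrite mulrC; apply: ler_pM.
Qed.

(** Write A^T 1 = al eps + e with |e| <= 2 del: the first part is al u, the second is bounded by the
    row sums of C. *)
Lemma cov_colsum_close j :
  `|\sum_i C j i * (\sum_k A k i) - (al * d * eps j + al * kap)| <= 12 * del / lam ^+ 2.
Proof.
case/andP: al01 => a0 a1.
have ll : 0 < lam /\ lam < 1 by apply/andP.
pose e i := \sum_k A k i - al * eps i.
have -> : \sum_i C j i * (\sum_k A k i) - (al * d * eps j + al * kap) =
  al * (u j - (d * eps j + kap)) + \sum_i C j i * e i.
  rewrite /u /e; transitivity (al * (\sum_i C j i * eps i) + \sum_i C j i * e i - (al * d * eps j + al * kap)).
    congr (_ - _); rewrite mulr_sumr -big_split/=.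
    by apply: eq_bigr => i _; rewrite /e; ring.
  by rewrite /e; ring.
have -> : 12 * del / lam ^+ 2 = 10 * del / lam / lam + 2 * del / lam / lam.
  by field; rewrite gt_eqF.
apply: le_trans (ler_normD _ _) _; apply: lerD.
  rewrite normrM -[leRHS]mul1r; apply: ler_pM => //; last exact: u_close.
  by rewrite ger0_norm//; lra.
have del2 : 0 <= 2 * del by rewrite mulr_ge0.
apply: le_trans (mulC_le j del2 hc) _.
by rewrite ler_peMr ?divr_ge0// ltW.
Qed.

End Perturbation.

(** * Both clustering rules on well separated data *)

Section Clustering.
Context {R : realType} {N : nat}.
Implicit Types (v : 'cV[R]_N) (S V : {set 'I_N}).

Lemma sum_cluster_mean v V : \sum_(i in V) v i 0 = #|V|%:R * cluster_mean v V.
Proof.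
have [V0|Vn] := posnP #|V|.
  by rewrite V0 mul0r (cards0_eq V0) big_set0.
by rewrite /cluster_mean mulrA divff ?mul1r// pnatr_eq0 -lt0n.
Qed.

Lemma cluster_mean_le v V (c : R) : V != finset.set0 ->
  \sum_(i in V) v i 0 <= #|V|%:R * c -> cluster_mean v V <= c.
Proof.
by rewrite -card_gt0 => V0; rewrite sum_cluster_mean ler_pM2l// ltr0n.
Qed.

Lemma cluster_mean_ge v V (c : R) : V != finset.set0 ->
  #|V|%:R * c <= \sum_(i in V) v i 0 -> c <= cluster_mean v V.
Proof.
by rewrite -card_gt0 => V0; rewrite sum_cluster_mean ler_pM2l// ltr0n.
Qed.

Lemma sse_min v V (c : R) :
  \sum_(i in V) (v i 0 - cluster_mean v V) ^+ 2 <= \sum_(i in V) (v i 0 - c) ^+ 2.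
Proof.
set m := cluster_mean v V.
have -> : \sum_(i in V) (v i 0 - c) ^+ 2 =
    \sum_(i in V) (v i 0 - m) ^+ 2 + #|V|%:R * (m - c) ^+ 2.
  have E i : (v i 0 - c) ^+ 2 = (v i 0 - m) ^+ 2 + (m - c) ^+ 2 + 2 * (m - c) * (v i 0 - m).
    by ring.
  under eq_bigr => i _ do rewrite E.
  rewrite !big_split/= -[X in _ + X]mulr_sumr big_split/= !sumr_const sum_cluster_mean -/m.
  by rewrite -[(_ ^+ 2) *+ _]mulr_natr -[(- m) *+ _]mulr_natr; ring.
by rewrite lerDl mulr_ge0 ?ler0n ?sqr_ge0.
Qed.

Lemma kmeans_costC v S : kmeans_cost v (~: S) = kmeans_cost v S.
Proof. by rewrite /kmeans_cost finset.setCK addrC. Qed.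

(* Moving a point to the other cluster cannot decrease an optimal cost. *)
Lemma kmeans_nearest v S i : two_clusters S ->
  (forall S', two_clusters S' -> kmeans_cost v S <= kmeans_cost v S') -> i \in S ->
  (v i 0 - cluster_mean v S) ^+ 2 <= (v i 0 - cluster_mean v (~: S)) ^+ 2.
Proof.
move=> /andP[S0 Sc0] opt iS.
(* A singleton cannot give up its point without leaving an empty cluster, but then the point is its
   own cluster mean. *)
have [E|S1] := eqVneq (S :\ i) finset.set0.
  have -> : cluster_mean v S = v i 0; last by rewrite subrr expr0n sqr_ge0.
  have -> : S = [set i]%SET by rewrite -(finset.setD1K iS) E finset.setU0.
  by rewrite /cluster_mean cards1 big_set1 invr1 mul1r.
have C : ~: (S :\ i) = i |: ~: S by rewrite finset.setCD finset.setUC.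
have tc : two_clusters (S :\ i).
  by rewrite /two_clusters S1 C; apply/finset.set0Pn; exists i; rewrite !inE eqxx.
have := opt _ tc; rewrite /kmeans_cost C.
set m1 := cluster_mean v S; set m2 := cluster_mean v (~: S).
have e2 : \sum_(j in i |: ~: S) (v j 0 - m2) ^+ 2 =
    (v i 0 - m2) ^+ 2 + \sum_(j in ~: S) (v j 0 - m2) ^+ 2.
  by rewrite big_setU1 ?inE ?iS.
have e1 : \sum_(j in S) (v j 0 - m1) ^+ 2 =
    (v i 0 - m1) ^+ 2 + \sum_(j in S :\ i) (v j 0 - m1) ^+ 2.
  by rewrite (big_setD1 i).
(* The modified clusters cost no more with their own means than with the old centres, so only the
   term of [i] is compared. *)
have := sse_min v (S :\ i) m1; have := sse_min v (i |: ~: S) m2.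
rewrite e1 e2; lra.
Qed.

Section Separated.
Variables (v : 'cV[R]_N) (Pp : {set 'I_N}) (g kap E r : R).
Hypotheses (g0 : 0 < g) (r0 : 0 < r) (E0 : 0 <= E) (Egr : 4 * E <= g * r).
Hypothesis N0 : (0 < N)%N.
Hypothesis vP : forall i, i \in Pp -> `|v i 0 - (kap + g)| <= E.
Hypothesis vM : forall i, i \notin Pp -> `|v i 0 - (kap - g)| <= E.
Hypotheses (cardP : r * N%:R <= #|Pp|%:R) (cardM : r * N%:R <= #|~: Pp|%:R).

Let NR0 : 0 < N%:R :> R. Proof. by rewrite ltr0n. Qed.

Let gr0 : 0 < g * r. Proof. exact: mulr_gt0. Qed.

Let r_half : 2 * r <= 1.
Proof.
have : #|Pp|%:R + #|~: Pp|%:R = N%:R :> R by rewrite -natrD cardsC card_ord.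
move: cardP cardM => cP cM h; rewrite -(ler_pM2r NR0); lra.
Qed.

Let grg : 2 * (g * r) <= g. Proof. have := ler_wpM2l (ltW g0) r_half; lra. Qed.

Local Ltac sep_lra := move: (g0) (r0) (E0) (Egr) (gr0) (r_half) (grg) => ? ? ? ? ? ? ?; lra.

Let vle i : v i 0 <= kap + g + E.
Proof.
have [/vP|/vM] := boolP (i \in Pp); rewrite ler_norml => /andP[]; sep_lra.
Qed.

Let vge i : kap - g - E <= v i 0.
Proof.
have [/vP|/vM] := boolP (i \in Pp); rewrite ler_norml => /andP[]; sep_lra.
Qed.

Let Pp0 : Pp != finset.set0.
Proof. by rewrite -card_gt0 -(ltr0n R); apply: lt_le_trans cardP; rewrite mulr_gt0. Qed.

Let Pm0 : ~: Pp != finset.set0.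
Proof. by rewrite -card_gt0 -(ltr0n R); apply: lt_le_trans cardM; rewrite mulr_gt0. Qed.

(** At least a fraction r of V lies near kap - g, at distance about 2g below the top level, and this
    pulls the mean down by 2gr. *)
Lemma mean_upper V : ~: Pp \subset V ->
  cluster_mean v V <= kap + g + E - 2 * (g * r).
Proof.
move=> PV; apply: cluster_mean_le.
  by apply: contraNneq Pm0 => V0; move: PV; rewrite V0 finset.subset0.
rewrite (finset.big_setID (~: Pp))/= (finset.setIidPr PV).
have h1 : \sum_(i in ~: Pp) v i 0 <= #|~: Pp|%:R * (kap - g + E).
  rewrite mulr_natl -sumr_const; apply: ler_sum => i.
  by rewrite inE => /vM; rewrite ler_norml => /andP[]; sep_lra.
have h2 : \sum_(i in V :\: ~: Pp) v i 0 <= #|V :\: ~: Pp|%:R * (kap + g + E).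
  by rewrite mulr_natl -sumr_const; apply: ler_sum.
have c : #|V|%:R = #|~: Pp|%:R + #|V :\: ~: Pp|%:R :> R.
  by rewrite -natrD -[in LHS](cardsID (~: Pp) V) (finset.setIidPr PV).
have VN : #|V|%:R <= N%:R :> R by rewrite ler_nat -[N in (_ <= N)%N]card_ord max_card.
have : g * (r * #|V|%:R) <= g * #|~: Pp|%:R.
  rewrite ler_pM2l//; apply: le_trans cardM; by rewrite ler_pM2l.
rewrite c in VN *; sep_lra.
Qed.

Lemma mean_lower V : Pp \subset V ->
  kap - g - E + 2 * (g * r) <= cluster_mean v V.
Proof.
move=> PV; apply: cluster_mean_ge.
  by apply: contraNneq Pp0 => V0; move: PV; rewrite V0 finset.subset0.
rewrite (finset.big_setID Pp)/= (finset.setIidPr PV).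
have h1 : #|Pp|%:R * (kap + g - E) <= \sum_(i in Pp) v i 0.
  rewrite mulr_natl -sumr_const; apply: ler_sum => i.
  by move=> /vP; rewrite ler_norml => /andP[]; sep_lra.
have h2 : #|V :\: Pp|%:R * (kap - g - E) <= \sum_(i in V :\: Pp) v i 0.
  by rewrite mulr_natl -sumr_const; apply: ler_sum.
have c : #|V|%:R = #|Pp|%:R + #|V :\: Pp|%:R :> R.
  by rewrite -natrD -[in LHS](cardsID Pp V) (finset.setIidPr PV).
have VN : #|V|%:R <= N%:R :> R by rewrite ler_nat -[N in (_ <= N)%N]card_ord max_card.
have : g * (r * #|V|%:R) <= g * #|Pp|%:R.
  rewrite ler_pM2l//; apply: le_trans cardP; by rewrite ler_pM2l.
rewrite c in VN *; sep_lra.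
Qed.

Lemma mean_threshold_separated : mean_threshold v = Pp.
Proof.
have M : N%:R^-1 * \sum_(j < N) v j 0 = cluster_mean v finset.setT.
  by rewrite /cluster_mean cardsT card_ord; congr (_ * _); apply: eq_bigl => j; rewrite inE.
have := mean_upper (finset.subsetT _); have := mean_lower (finset.subsetT _).
rewrite /mean_threshold M; set m := cluster_mean _ _ => mlo mup.
apply/finset.setP => i; rewrite inE; have [/vP|/vM] := boolP (i \in Pp);
  rewrite ler_norml => /andP[h1 h2].
- apply/idP; sep_lra.
- apply/negbTE; rewrite -ltNge; sep_lra.
Qed.

Lemma kmeans_cost_true : kmeans_cost v Pp <= N%:R * E ^+ 2.
Proof.
have sqE (z : R) : `|z| <= E -> z ^+ 2 <= E ^+ 2.
  by move=> zD; rewrite -[z ^+ 2]real_normK ?num_real// ler_sqr ?nnegrE.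
apply: le_trans (lerD (sse_min v Pp (kap + g)) (sse_min v (~: Pp) (kap - g))) _.
have -> : N%:R * E ^+ 2 = \sum_(i in Pp) E ^+ 2 + \sum_(i in ~: Pp) E ^+ 2.
  by rewrite !sumr_const -mulrnDr cardsC card_ord mulr_natl.
apply: lerD; apply: ler_sum => i.
- by move=> /vP; exact: sqE.
- by rewrite inE => /vM; exact: sqE.
Qed.

Lemma kmeans_separated S : is_kmeans v S -> S = Pp.
Proof.
move=> [tc opt le12].
set m1 := cluster_mean v S in le12; set m2 := cluster_mean v (~: S) in le12.
have tcC : two_clusters (~: S) by rewrite /two_clusters finset.setCK andbC.
have near1 i : i \in S -> (v i 0 - m1) ^+ 2 <= (v i 0 - m2) ^+ 2.
  by move=> iS; exact: kmeans_nearest.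
have near2 i : i \notin S -> (v i 0 - m2) ^+ 2 <= (v i 0 - m1) ^+ 2.
  move=> iS; have := @kmeans_nearest v (~: S) i tcC; rewrite finset.setCK inE iS; apply=> //.
  by move=> S' /opt; rewrite kmeans_costC.
(* With equal means the cost would be that of one single centre. One community lies at distance at
   least g - E from it, so the cost is at least r N (g - E)^2, more than the N E^2 achieved by the
   true partition. *)
have lt12 : m2 < m1.
  rewrite lt_neqAle le12 andbT; apply/eqP => m12.
  have cS : \sum_i (v i 0 - m1) ^+ 2 <= N%:R * E ^+ 2.
    apply: le_trans kmeans_cost_true; apply: le_trans (opt Pp _); last first.
      by rewrite /two_clusters Pp0.
    rewrite /kmeans_cost -/m1 -/m2 m12 le_eqVlt; apply/orP; left; apply/eqP.
    rewrite (bigID (mem S))/=; congr (_ + _); apply: eq_bigl => i; by rewrite ?inE.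
  have sub (V : {set 'I_N}) : r * N%:R <= #|V|%:R ->
      (forall i, i \in V -> (g - E) ^+ 2 <= (v i 0 - m1) ^+ 2) ->
      r * N%:R * (g - E) ^+ 2 <= \sum_i (v i 0 - m1) ^+ 2.
    move=> cV hV; apply: (@le_trans _ _ (#|V|%:R * (g - E) ^+ 2)).
      by apply: ler_wpM2r; rewrite ?sqr_ge0.
    rewrite mulr_natl -sumr_const [leRHS](bigID (mem V))/= -[leLHS]addr0.
    apply: lerD; first exact: ler_sum.
    by apply: sumr_ge0 => i _; exact: sqr_ge0.
  have big : r * N%:R * (g - E) ^+ 2 <= \sum_i (v i 0 - m1) ^+ 2.
    case: (leP m1 kap) => mk.
    - apply: (sub Pp) => // i /vP; rewrite ler_norml => /andP[h1 h2].
      by rewrite ler_sqr ?nnegrE; sep_lra.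
    - apply: (sub (~: Pp)) => // i; rewrite inE => /vM; rewrite ler_norml => /andP[h1 h2].
      by rewrite -(sqrrN (v i 0 - m1)) ler_sqr ?nnegrE; sep_lra.
  have := le_trans big cS.
  rewrite [r * _]mulrC -mulrA ler_pM2l//; apply/negP; rewrite -ltNge.
  have h : E ^+ 2 <= (g * r / 4) ^+ 2 by rewrite ler_sqr ?nnegrE; sep_lra.
  have h' : (g - g * r / 4) ^+ 2 <= (g - E) ^+ 2 by rewrite ler_sqr ?nnegrE; sep_lra.
  apply: le_lt_trans h _; apply: lt_le_trans (ler_wpM2l (ltW r0) h').
  have -> : (g * r / 4) ^+ 2 = r * (r * g ^+ 2 / 16) by field.
  have -> : (g - g * r / 4) ^+ 2 = g ^+ 2 * (1 - r / 4) ^+ 2 by ring.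
  rewrite ltr_pM2l//.
  have -> : r * g ^+ 2 / 16 = g ^+ 2 * (r / 16) by ring.
  rewrite ltr_pM2l ?exprn_gt0//; have := sqr_ge0 r; sep_lra.
(* Being nearest to its own mean places each point on the correct side of the midpoint, so it
   remains to locate h strictly between the two data bands. *)
pose h := (m1 + m2) / 2.
have Sh i : i \in S -> h <= v i 0.
  move=> /near1; rewrite -subr_ge0.
  have -> : (v i 0 - m2) ^+ 2 - (v i 0 - m1) ^+ 2 = 2 * (m1 - m2) * (v i 0 - h).
    by rewrite /h; field.
  by rewrite pmulr_rge0 ?subr_ge0// mulr_gt0 ?subr_gt0.
have Sch i : i \notin S -> v i 0 <= h.
  move=> /near2; rewrite -subr_ge0.
  have -> : (v i 0 - m1) ^+ 2 - (v i 0 - m2) ^+ 2 = 2 * (m1 - m2) * (h - v i 0).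
    by rewrite /h; field.
  by rewrite pmulr_rge0 ?subr_ge0// mulr_gt0 ?subr_gt0.
have hdef : 2 * h = m1 + m2 by rewrite /h; field.
(* Otherwise the whole minus community lies below h, hence in [~: S]; [mean_upper] lowers m2 by 2gr,
   and then 2h = m1 + m2 is too small because 4E <= gr. *)
have h_low : h < kap + g - E.
  rewrite ltNge; apply/negP => hh.
  have sub : ~: Pp \subset ~: S.
    apply/fintype.subsetP => i; rewrite !inE => iP; apply/negP => /Sh.
    by move/vM: iP; rewrite ler_norml => /andP[]; sep_lra.
  have := mean_upper sub; rewrite -/m2.
  have : m1 <= kap + g + E.
    case/andP: tc => S0 _; apply: cluster_mean_le => //.
    by rewrite mulr_natl -sumr_const; apply: ler_sum.
  sep_lra.
have h_up : kap - g + E < h.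
  rewrite ltNge; apply/negP => hh.
  have sub : Pp \subset S.
    apply/fintype.subsetP => i iP; apply: contraLR isT => /Sch.
    by move/vP: iP; rewrite ler_norml => /andP[]; sep_lra.
  have := mean_lower sub; rewrite -/m1.
  have : kap - g - E <= m2.
    case/andP: tc => _ S0; apply: cluster_mean_ge => //.
    by rewrite mulr_natl -sumr_const; apply: ler_sum.
  sep_lra.
apply/finset.setP => i; have [/vP|/vM] := boolP (i \in Pp); rewrite ler_norml => /andP[h1 h2].
- by apply/idP/contraT => /Sch; sep_lra.
- by apply/negP => /Sh; sep_lra.
Qed.

Lemma clustering_separated b S : is_clustering b v S -> S = Pp.
Proof.
by case: b => [/kmeans_separated|/= ->] //; exact: mean_threshold_separated.
Qed.

End Separated.
End Clustering.

(** * Events determined by finitely valued variables *)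

Section FiniteEvents.
Context {d : measure_display} {Omega : measurableType d} {R : realType}.
Variable P : probability Omega R.
Implicit Types (A B : set Omega).

Definition pr A : R := fine (P A).

Lemma prE A : measurable A -> P A = (pr A)%:E.
Proof. by move=> mA; rewrite fineK// fin_num_measure. Qed.

Lemma pr_ge0 A : 0 <= pr A.
Proof. by rewrite fine_ge0. Qed.

Lemma pr_set0 : pr set0 = 0.
Proof. by rewrite /pr measure0. Qed.

Lemma le_pr A B : measurable A -> measurable B -> A `<=` B -> pr A <= pr B.
Proof.
move=> mA mB AB; rewrite -lee_fin -!prE//.
by apply: le_measure; rewrite ?inE.
Qed.

Lemma measurable_preimage_fin (K : finType) (Z : Omega -> K) (D : set K) :
  (forall k, measurable [set w | Z w = k]) -> measurable [set w | D (Z w)].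
Proof.
move=> mZ; have -> : [set w | D (Z w)] = \bigcup_(k in D) [set w | Z w = k].
  by apply/seteqP; split => [w Dw|w [k Dk /= ->]] //; exists (Z w).
by apply: fin_bigcup_measurable => // ; exact: finite_finset.
Qed.

Lemma pr_split (K : finType) (Z : Omega -> K) A :
  (forall k, measurable [set w | Z w = k]) -> measurable A ->
  pr A = \sum_k pr (A `&` [set w | Z w = k]).
Proof.
move=> mZ mA.
have H (r : seq K) : uniq r ->
    pr (A `&` [set w | Z w \in r]) = \sum_(k <- r) pr (A `&` [set w | Z w = k]).
  elim: r => [_|k r IH /= /andP[kr ur]].
    rewrite big_nil -[RHS]pr_set0; congr pr.
    by apply/seteqP; split => // w [].
  rewrite big_cons -(IH ur).
  have -> : A `&` [set w | Z w \in k :: r] =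
      (A `&` [set w | Z w = k]) `|` (A `&` [set w | Z w \in r]).
    apply/seteqP; split => [w [Aw]|w [[Aw /= Zk]|[Aw /= Zr]]].
    - by rewrite /= inE => /orP[/eqP|]; [left|right].
    - by split => //=; rewrite Zk inE eqxx.
    - by split => //=; rewrite inE Zr orbT.
  have m1 : measurable (A `&` [set w | Z w = k]) by exact: measurableI.
  have m2 : measurable (A `&` [set w | Z w \in r]).
    apply: measurableI => //; exact: (measurable_preimage_fin (fun k => k \in r)).
  rewrite {1}/pr measureU// ?fineD ?fin_num_measure//.
  apply/seteqP; split => // w /= [[_ /= Zk] [_ /= Zr]].
  by rewrite -Zk Zr in kr.
rewrite -big_enum /= -H ?enum_uniq//; congr pr.
by apply/seteqP; split => [w Aw|w []//]; split => //=; rewrite mem_enum.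
Qed.

Lemma measurable_ffun_eq (I : finType) (Y : I -> {RV P >-> bool}) (y : {ffun I -> bool}) :
  measurable [set w | [ffun i => Y i w] = y].
Proof.
have -> : [set w | [ffun i => Y i w] = y] = \bigcap_(i in [set: I]) (Y i @^-1` [set y i]).
  apply/seteqP; split => [w /= <- i _ /=|w H /=]; first by rewrite ffunE.
  by apply/ffunP => i; rewrite ffunE; apply: H.
apply: fin_bigcap_measurable => [|i _]; first exact: finite_finset.
exact: measurable_funPTI.
Qed.

End FiniteEvents.

Section Environment.
Context {d : measure_display} {Omega : measurableType d} {R : realType}.
Variable P : probability Omega R.

Lemma pr_iid_bernoulli (I : finType) (Y : I -> {RV P >-> bool}) (p : R) (y : {ffun I -> bool}) :
  0 <= p <= 1 -> mutually_independent Y ->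
  (forall i, distribution P (Y i) = bernoulli_prob p :> (set bool -> \bar R)) ->
  pr P [set w | [ffun i => Y i w] = y] = bern_weight (fun=> p) y.
Proof.
move=> p01 indep law.
have -> : [set w | [ffun i => Y i w] = y] = \bigcap_(i in [set` [set: I]%SET]) (Y i @^-1` [set y i]).
  apply/seteqP; split => [w /= <- i _ /=|w H /=]; first by rewrite ffunE.
  by apply/ffunP => i; rewrite ffunE; apply: H; rewrite /= inE.
rewrite /pr (indep finset.setT (fun i => [set y i]))//.
have E i : P (Y i @^-1` [set y i]) = (bernoulli_pmf p (y i))%:E.
  have /(congr1 (fun f => f [set y i])) := law i.
  rewrite /distribution /pushforward => ->.
  rewrite bernoulli_probE// !diracE /bernoulli_pmf.
  case: (y i).
    by rewrite mem_set// memNset//= mule1 mule0 adde0.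
  by rewrite memNset// mem_set//= mule1 mule0 add0e.
under eq_bigr do rewrite E.
rewrite prodEFin /= /bern_weight; apply: eq_bigl => i; by rewrite inE.
Qed.

End Environment.

(** * Law of the path given the environment *)

Section PathLaw.
Context {d : measure_display} {Omega : measurableType d} {R : realType} {N : nat}.
Variables (P : probability Omega R) (X : int -> 'I_N -> {RV P >-> bool}).
Local Notation S := {ffun 'I_N -> bool}.
Variables (B : set Omega) (q : S -> 'I_N -> R).
Hypothesis mB : measurable B.
Hypothesis B0 : P B != 0%E.
Hypothesis stationary : cond_stationary X B.
Hypothesis markov : cond_markov X B (fun x y => bern_weight (q x) y).

(** Path time 0 is chain time 1, the first sampled time. *)
Definition path (w : Omega) (k : nat) : S := state_at X (1 + k%:Z) w.

Definition stat_law (x : S) : R := pr P ([set w | path w 0 = x] `&` B) / pr P B.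

Lemma measurable_state (t : int) (x : S) : measurable [set w | state_at X t w = x].
Proof. exact: measurable_ffun_eq. Qed.

Lemma path_eventS n (x : nat -> S) : path_event X 1 n.+1 x =
  path_event X 1 n x `&` [set w | path w n.+1 = x n.+1].
Proof.
apply/seteqP; split => [w H|w [H1 H2] k] /=.
  by split => [k kn|]; [apply: H; exact: leqW|apply: H].
by rewrite leq_eqVlt => /orP[/eqP -> //|kn]; apply: H1.
Qed.

Lemma path_event0 (x : nat -> S) : path_event X 1 0 x = [set w | path w 0 = x 0%N].
Proof.
apply/seteqP; split => [w H|w H k] /=; first exact: H.
by rewrite leqn0 => /eqP ->.
Qed.

Lemma measurable_path_event n (x : nat -> S) : measurable (path_event X 1 n x).
Proof.
elim: n => [|n IH]; first by rewrite path_event0; exact: measurable_state.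
by rewrite path_eventS; apply: measurableI => //; exact: measurable_state.
Qed.

Lemma eq_path_event n (x y : nat -> S) : (forall k, (k <= n)%N -> x k = y k) ->
  path_event X 1 n x = path_event X 1 n y.
Proof.
by move=> xy; apply/seteqP; split => w H k kn; rewrite (H k kn) xy.
Qed.

Let prB0 : 0 < pr P B.
Proof.
rewrite lt_def pr_ge0 andbT; apply: contra B0 => /eqP h.
by rewrite prE// h.
Qed.

Lemma pr_path_next n (x : nat -> S) (y : S) :
  pr P ([set w | path w n.+1 = y] `&` (path_event X 1 n x `&` B)) =
  pr P (path_event X 1 n x `&` B) * bern_weight (q (x n)) y.
Proof.
have mA : measurable (path_event X 1 n x `&` B).
  by apply: measurableI => //; exact: measurable_path_event.
have mY : measurable [set w | path w n.+1 = y] by exact: measurable_state.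
(* The Markov hypothesis says nothing about a null past, but both sides are 0 there. *)
have [A0|A0] := eqVneq (P (path_event X 1 n x `&` B)) 0%E.
  have E0 : pr P (path_event X 1 n x `&` B) = 0 by rewrite /pr A0.
  rewrite E0 mul0r; apply/eqP; rewrite eq_le pr_ge0 andbT -[leRHS]E0.
  by apply: le_pr => //; exact: measurableI.
have := markov y A0; rewrite /cond_prob -!/(pr P _) => <-.
rewrite mulrC mulfVK//; apply: contra A0 => /eqP h.
by rewrite prE// h.
Qed.

Lemma stat_law_ge0 x : 0 <= stat_law x.
Proof. by rewrite divr_ge0 ?pr_ge0. Qed.

Lemma stat_law_sum1 : \sum_x stat_law x = 1.
Proof.
rewrite -mulr_suml; under eq_bigr do rewrite setIC.
by rewrite -pr_split// ?divff ?gt_eqF// => x; exact: measurable_state.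
Qed.

Lemma pr_path0 x : pr P ([set w | path w 0 = x] `&` B) = pr P B * stat_law x.
Proof. by rewrite mulrC mulfVK// gt_eqF. Qed.

Lemma pr_path1 y : pr P ([set w | path w 1 = y] `&` B) = pr P B * stat_law y.
Proof.
have := stationary 1 1 0 (fun=> y); rewrite /cond_prob -!/(pr P _) path_event0.
have -> : path_event X (1 + 1) 0 (fun=> y) = [set w | path w 1 = y].
  apply/seteqP; split => [w H|w H k] /=; first by have := H 0%N isT; rewrite addr0.
  by rewrite leqn0 => /eqP ->; rewrite addr0.
by move=> h; rewrite /stat_law -h mulrC mulfVK// gt_eqF.
Qed.

(** Summing the Markov property over the state at time 1 gives the law at time 2, which conditional
    stationarity identifies with the law at time 1. *)
Lemma stat_law_step f : statE stat_law (step q f) = statE stat_law f.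
Proof.
have E y : \sum_x stat_law x * bern_weight (q x) y = stat_law y.
  apply: (mulfI (lt0r_neq0 prB0)); rewrite -pr_path1 mulr_sumr.
  have mY : measurable ([set w | path w 1 = y] `&` B).
    by apply: measurableI => //; exact: measurable_state.
  rewrite (@pr_split _ _ _ _ _ (fun w => path w 0) _ _ mY); last first.
    by move=> x; exact: measurable_state.
  apply: eq_bigr => x _; rewrite mulrA -pr_path0.
  rewrite -(path_event0 (fun=> x)) -(pr_path_next 0 (fun=> x)) path_event0; congr pr.
  by rewrite -setIA [B `&` _]setIC.
rewrite /statE /step /bernE; under eq_bigr do rewrite mulr_sumr.
rewrite exchange_big; apply: eq_bigr => y _; rewrite -E mulr_suml.
by apply: eq_bigr => x _; rewrite mulrA.
Qed.

Lemma measurable_path_pred n (G : (nat -> S) -> bool) :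
  (forall s s' : nat -> S, (forall k, (k <= n)%N -> s k = s' k) -> G s = G s') ->
  measurable [set w | G (path w)].
Proof.
move=> Gloc; pose Z (w : Omega) : {ffun 'I_n.+1 -> S} := [ffun k : 'I_n.+1 => path w k].
have EG w : G (path w) = G (fun k => Z w (inord k)).
  by apply: Gloc => k kn; rewrite ffunE inordK.
have -> : [set w | G (path w)] = [set w | G (fun k => Z w (inord k))].
  by apply/seteqP; split => w /=; rewrite EG.
apply: (measurable_preimage_fin (fun z : {ffun 'I_n.+1 -> S} => G (fun k => z (inord k)))) => z.
have -> : [set w | Z w = z] = path_event X 1 n (fun k => z (inord k)).
  apply/seteqP; split => [w /= <- k kn|w H /=]; first by rewrite ffunE inordK.
  by apply/ffunP => k; rewrite ffunE /path H ?inord_val// -ltnS.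
exact: measurable_path_event.
Qed.

(** Stated for an arbitrary past so that induction on the n remaining steps can split on the state
    at time m + 1 and absorb it into the past. *)
Lemma pr_path_from n m (x : nat -> S) (G : (nat -> S) -> bool) :
  (forall s s' : nat -> S, (forall k, (k <= m + n)%N -> s k = s' k) -> G s = G s') ->
  pr P ([set w | G (path w)] `&` (path_event X 1 m x `&` B)) =
  pr P (path_event X 1 m x `&` B) *
  PE q n (x m) (fun s => (G (fun k => if (k < m)%N then x k else s (k - m)%N))%:R).
Proof.
elim: n m x => [|n IH] m x Gloc.
  have Gx w : path_event X 1 m x w -> G (path w) = G x.
    by move=> H; apply: Gloc => k; rewrite addn0 => km; apply: H.
  rewrite /= (_ : G _ = G x); last first.
    apply: Gloc => k; rewrite addn0 leq_eqVlt => /orP[/eqP ->|->//].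
    by rewrite ltnn.
  case E : (G x) => /=.
    rewrite mulr1; congr pr; apply/seteqP; split => [w []//|w H]; split => //=.
    by case: H => H _; rewrite Gx.
  rewrite mulr0 -[RHS](pr_set0 P); congr pr; apply/seteqP; split => // w [/= Gw [H _]].
  by rewrite Gx// E in Gw.
pose ext y k := if (k <= m)%N then x k else y.
have extE y : path_event X 1 m.+1 (ext y) = path_event X 1 m x `&` [set w | path w m.+1 = y].
  rewrite path_eventS {2}/ext ltnn; congr (_ `&` _).
  by apply: eq_path_event => k km; rewrite /ext km.
have mA : measurable ([set w | G (path w)] `&` (path_event X 1 m x `&` B)).
  apply: measurableI; last by apply: measurableI => //; exact: measurable_path_event.
  exact: measurable_path_pred Gloc.
rewrite (@pr_split _ _ _ _ _ (fun w => path w m.+1) _ _ mA); last first.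
  by move=> y; exact: measurable_state.
rewrite /= /step /bernE mulr_sumr; apply: eq_bigr => y _.
have -> : [set w | G (path w)] `&` (path_event X 1 m x `&` B) `&` [set w | path w m.+1 = y] =
    [set w | G (path w)] `&` (path_event X 1 m.+1 (ext y) `&` B).
  by rewrite extE -!setIA [B `&` _]setIC.
rewrite IH; last by move=> s s' ss'; apply: Gloc => k; rewrite addnS -addSn; exact: ss'.
rewrite mulrA; congr (_ * _).
  rewrite -pr_path_next extE; congr pr; by rewrite [RHS]setIC -!setIA [B `&` _]setIC.
rewrite {1}/ext ltnn; apply: eq_PE => s _; congr (nat_of_bool (G _))%:R.
apply/funext => k; rewrite ltnS leq_eqVlt.
have [->|km] := eqVneq k m; first by rewrite ltnn /ext leqnn subnn.
rewrite /=; case: ltngtP km => // km _; first by rewrite /ext ltnW.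
by rewrite -(subnSK km).
Qed.

Lemma pr_path n (G : (nat -> S) -> bool) :
  (forall s s' : nat -> S, (forall k, (k <= n)%N -> s k = s' k) -> G s = G s') ->
  pr P ([set w | G (path w)] `&` B) =
  pr P B * pathE q stat_law n (fun s => (G s)%:R).
Proof.
move=> Gloc.
have mG := measurable_path_pred Gloc.
rewrite (@pr_split _ _ _ _ _ (fun w => path w 0)); last 2 first.
- by move=> y; exact: measurable_state.
- exact: measurableI.
rewrite /pathE /statE mulr_sumr; apply: eq_bigr => x _.
rewrite -setIA [B `&` _]setIC -(path_event0 (fun=> x)) (@pr_path_from n 0 (fun=> x) G)//.
rewrite mulrA path_event0 pr_path0; congr (_ * PE _ _ _ _).
by apply/funext => s; congr (nat_of_bool (G _))%:R; apply/funext => k; rewrite subn0.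
Qed.

End PathLaw.

Lemma bernE_dev (R : realType) (I : finType) (q D : I -> R)
    (f : {ffun I -> bool} -> R) (V z : R) :
  (forall i, 0 <= q i <= 1) -> coord_lip D f -> \sum_i D i ^+ 2 <= V ->
  0 < z -> 0 < V ->
  bernE q (fun x => (z <= `|f x - bernE q f|)%R%:R) <= 2 * expR (- (z ^+ 2 / (8 * V))).
Proof.
(* The minimizer of - t z + 2 t^2 V. *)
move=> q01 fD DV z0 V0; pose t := z / (4 * V).
have t0 : 0 < t by rewrite /t divr_gt0 ?mulr_gt0.
have T (e : R) : `|e| = 1 ->
    bernE q (fun x => expR (t * (e * (f x - bernE q f)))) <= expR (2 * (t ^+ 2 * V)).
  move=> e1; have L : coord_lip (fun i => t * D i) (fun x => t * (e * (f x - bernE q f))).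
    move=> x i b; rewrite -!mulrBr normrM [`|e * _|]normrM e1 mul1r (gtr0_norm t0) ler_pM2l//.
    by rewrite opprB addrA subrK; exact: fD.
  apply: le_trans (bernE_exp q01 L) _; rewrite ler_expR !bernEZ bernED bernE_cst subrr !mulr0 add0r.
  rewrite ler_pM2l//.
  have -> : \sum_i (t * D i) ^+ 2 = t ^+ 2 * \sum_i D i ^+ 2.
    by rewrite mulr_sumr; apply: eq_bigr => i _; rewrite exprMn.
  by rewrite ler_pM2l ?exprn_gt0.
apply: (@le_trans _ _ (bernE q (fun x => expR (- (t * z)) * expR (t * (1 * (f x - bernE q f))) +
                              expR (- (t * z)) * expR (t * (-1 * (f x - bernE q f)))))).
  apply: le_bernE => // x; rewrite -!expRD ler_normr mul1r mulN1r.
  set y := f x - _.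
  have := expR_ge0 (- (t * z) + t * y); have := expR_ge0 (- (t * z) + t * - y).
  case: (boolP (z <= y)) => [h _ _|_] /=; [|case: (boolP (z <= - y)) => [h _ _|_] /=].
  - rewrite -[leLHS]addr0; apply: lerD (expR_ge0 _).
    by rewrite /= ?mulr1n -[leLHS]expR0 ler_expR -mulrN -mulrDr mulr_ge0 ?(ltW t0)//; lra.
  - rewrite -[leLHS]add0r; apply: lerD; first exact: expR_ge0.
    by rewrite /= ?mulr1n -[leLHS]expR0 ler_expR -mulrN -mulrDr mulr_ge0 ?(ltW t0)//; lra.
  - by move=> ? ?; rewrite /= ?mulr0n; apply: addr_ge0.
rewrite bernED !bernEZ -mulrDr.
have E1 : - (t * z) + 2 * (t ^+ 2 * V) = - (z ^+ 2 / (8 * V)).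
  by rewrite /t; field; rewrite gt_eqF.
rewrite -E1 expRD [leRHS]mulrCA; apply: ler_wpM2l; first exact: expR_ge0.
by rewrite [leRHS]mulr_natl mulr2n; apply: lerD; apply: T; rewrite ?normrN normr1.
Qed.

Lemma expRN_le_inv_sqr (R : realType) (x : R) : 0 < x -> expR (- x) <= 2 / x ^+ 2.
Proof.
move=> x0; have := expR_ge1Dxn 1 (ltW x0) => h.
rewrite expRN -[leRHS]invrK lef_pV2 ?posrE ?expR_gt0 ?invr_gt0 ?divr_gt0 ?exprn_gt0//.
rewrite invf_div; apply: le_trans h.
by rewrite [2`!]/= ler_wpDl.
Qed.

(** * Row and column averages of the environment *)

Section GoodEnvironment.
Context {R : realType} {N : nat}.
Local Notation env := {ffun 'I_N * 'I_N -> bool}.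
Variable p : R.
Hypothesis p01 : 0 <= p <= 1.
Hypothesis N0 : (0 < N)%N.
Implicit Types (V : {set 'I_N}) (a : env) (g : 'I_N -> 'I_N * 'I_N).

(** The map [g] picks one line of the matrix, a row or a column, so that both are treated at
    once. *)
Definition avg_over g V a : R := N%:R^-1 * \sum_(j in V) (a (g j))%:R.

Let NR : 0 < N%:R :> R. Proof. by rewrite ltr0n. Qed.

Lemma avg_over_dev g V (z : R) : injective g -> 0 < z ->
  bernE (fun=> p) (fun a => (z <= `|avg_over g V a - p * (#|V|%:R / N%:R)|)%R%:R)
  <= 2 * expR (- (z ^+ 2 * N%:R / 8)).
Proof.
move=> g_inj z0.
have mean : bernE (fun=> p) (avg_over g V) = p * (#|V|%:R / N%:R).
  rewrite /avg_over bernEZ bernE_sum.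
  under eq_bigr do rewrite bernE_coord.
  by rewrite sumr_const -[_ *+ _]mulr_natr; ring.
pose D (e : 'I_N * 'I_N) : R := N%:R^-1 * \sum_(j in V) (e == g j)%:R.
have L : coord_lip D (avg_over g V).
  move=> a e b; rewrite /avg_over -mulrBr normrM gtr0_norm ?invr_gt0//.
  rewrite ler_pM2l ?invr_gt0// -sumrB; apply: le_trans (ler_norm_sum _ _ _) _.
  apply: ler_sum => j _; rewrite updE eq_sym; case: eqP => _; last by rewrite subrr normr0.
  exact: bool_diff_le1.
have D0 e : 0 <= D e by rewrite mulr_ge0 ?invr_ge0// sumr_ge0.
have D1 e : D e <= N%:R^-1.
  rewrite /D -[leRHS]mulr1 ler_pM2l ?invr_gt0//.
  have [/existsP[j /andP[jV /eqP ->]]|/existsPn H] := boolP [exists j, (j \in V) && (e == g j)].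
    rewrite (bigD1 j)//= eqxx big1 ?addr0// => k /andP[_ kj].
    by rewrite (inj_eq g_inj) eq_sym (negPf kj).
  rewrite big1// => j jV; have := H j; rewrite jV /= => /negPf ->//.
have DV : \sum_e D e ^+ 2 <= N%:R^-1.
  apply: (@le_trans _ _ (\sum_e N%:R^-1 * D e)).
    by apply: ler_sum => e _; rewrite expr2 ler_wpM2r.
  rewrite -mulr_sumr -[leRHS]mulr1 ler_pM2l ?invr_gt0// /D -mulr_sumr.
  rewrite exchange_big /= mulrC ler_pdivrMr// mul1r.
  rewrite (eq_bigr (fun=> 1)) => [|j _].
    by rewrite sumr_const ler_nat -[N in (_ <= N)%N]card_ord max_card.
  by rewrite (bigD1 (g j))//= eqxx big1 ?addr0// => e /negPf ->.
have iN : 0 < N%:R^-1 :> R by rewrite invr_gt0.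
have := bernE_dev (fun=> p01) L DV z0 iN; rewrite mean.
have -> : z ^+ 2 / (8 * N%:R^-1) = z ^+ 2 * N%:R / 8 by field; rewrite gt_eqF.
by [].
Qed.

Definition rows (i j : 'I_N) := (i, j).
Definition cols (j i : 'I_N) := (i, j).

Definition balanced (del : R) V a : bool :=
  [forall i, (`|avg_over (rows i) V a - p * (#|V|%:R / N%:R)| <= del) &&
             (`|avg_over (cols i) V a - p * (#|V|%:R / N%:R)| <= del)].

(** Union bound over 2N lines with tail 2 exp(-x), x = del^2 N / 8. The estimate exp(-x) <= 2/x^2
    absorbs the factor N and leaves 4 * 2 * 64 = 512. *)
Lemma balanced_prob (del : R) V : 0 < del ->
  bernE (fun=> p) (fun a => (~~ balanced del V a)%:R) <= 512 / (del ^+ 4 * N%:R).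
Proof.
move=> del0; pose dv g a := `|avg_over g V a - p * (#|V|%:R / N%:R)|.
apply: (@le_trans _ _ (bernE (fun=> p) (fun a =>
  \sum_i ((del <= dv (rows i) a)%R%:R + (del <= dv (cols i) a)%R%:R)))).
  apply: le_bernE => // a.
  have S0 : 0 <= \sum_i ((del <= dv (rows i) a)%R%:R + (del <= dv (cols i) a)%R%:R) :> R.
    by apply: sumr_ge0 => i _; apply: addr_ge0.
  have [|/forallPn[i]] := boolP (balanced del V a); first by [].
  rewrite negb_and -!ltNge => h.
  apply: (@le_trans _ _ 1) => //; rewrite (bigD1 i)//= -[leLHS]addr0; apply: lerD; last first.
    by apply: sumr_ge0 => k _; apply: addr_ge0.
  by case/orP: h => /ltW ->; rewrite ?lerDl ?lerDr.
rewrite bernE_sum; apply: (@le_trans _ _ (\sum_(i < N) 4 * expR (- (del ^+ 2 * N%:R / 8)))).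
  apply: ler_sum => i _; rewrite bernED.
  have -> : 4 * expR (- (del ^+ 2 * N%:R / 8)) =
    2 * expR (- (del ^+ 2 * N%:R / 8)) + 2 * expR (- (del ^+ 2 * N%:R / 8)) by ring.
  apply: lerD; apply: avg_over_dev => //.
  - by move=> x y [].
  - by move=> x y [].
rewrite sumr_const card_ord -[_ *+ N]mulr_natr.
have x0 : 0 < del ^+ 2 * N%:R / 8 by rewrite divr_gt0// mulr_gt0// exprn_gt0.
apply: (@le_trans _ _ (4 * (2 / (del ^+ 2 * N%:R / 8) ^+ 2) * N%:R)).
  by rewrite ler_pM2r// ler_pM2l// expRN_le_inv_sqr.
rewrite le_eqVlt; apply/orP; left; apply/eqP; field.
by rewrite !gt_eqF.
Qed.

End GoodEnvironment.

(** * Consequences of the sample size condition *)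

Section Numerics.
Context {R : realType}.
Implicit Types (T : nat) (x : R).

Lemma ln2_ge_half : 2^-1 <= ln 2 :> R.
Proof.
rewrite -ler_expR lnK ?posrE//.
have := @expR_le_quad R 2^-1 (lexx _); lra.
Qed.

(** For the last bound, put L = ln T and compare W = ln(N L) with L/4. If W >= L/4, the hypothesis
    with K3 >= 4K suffices. Otherwise N L <= T^(1/4), so N L^2 <= (N L)^2 <= sqrt T, while K <= sqrt
    T because K^2 <= K3 <= T. *)
Lemma sample_size_bounds (K K3 : R) N T : 0 < K -> 4 + 4 * K + K ^+ 2 <= K3 ->
  (8 <= N)%N -> (2 <= T)%N ->
  K3 * N%:R * ln T%:R * ln (N%:R * ln T%:R) <= T%:R ->
  [/\ 2^-1 <= ln T%:R :> R, 0 < ln (N%:R * ln T%:R : R), 2 * N%:R <= T%:R :> R,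
      K3 <= T%:R & K * N%:R * ln T%:R ^+ 2 <= T%:R].
Proof.
move=> K0 hK N8 T2; set L := ln T%:R; set W := ln _ => hT.
have T0 : 0 < T%:R :> R by rewrite ltr0n (leq_trans _ T2).
have L1 : 2^-1 <= L.
  by apply: le_trans ln2_ge_half _; rewrite ler_ln ?posrE// ler_nat.
have NR : 8 <= N%:R :> R by rewrite ler_nat.
have NL : 4 <= N%:R * L by apply: (@le_trans _ _ (8 * 2^-1)); [lra|apply: ler_pM; lra].
have W1 : 1 <= W.
  have h4 : 2 * ln 2 = ln 4 :> R.
    have -> : 4 = 2 * 2 :> R by ring.
    by rewrite lnM ?posrE//; ring.
  have : ln 4 <= W by rewrite ler_ln ?posrE//; lra.
  have := ln2_ge_half; lra.
have K30 : 4 <= K3 by have := sqr_ge0 K; lra.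
have hNLW : K3 * (N%:R * L) <= T%:R.
  apply: le_trans hT; rewrite -[K3 * _ * _]mulrA ler_peMr//.
  by apply: mulr_ge0; lra.
have hTN : K3 * N%:R * 2^-1 <= T%:R.
  by apply: le_trans hNLW; rewrite mulrA ler_wpM2l//; apply: mulr_ge0; lra.
split => //.
- by lra.
- apply: le_trans hTN; nra.
- apply: le_trans hTN; nra.
have [h|h] := leP (L / 4) W.
  apply: le_trans hT.
  have -> : K * N%:R * L ^+ 2 = (4 * K) * (N%:R * L) * (L / 4) by field.
  rewrite -[K3 * _ * L]mulrA; apply: ler_pM => //.
  - by rewrite !mulr_ge0//; lra.
  - lra.
  - by rewrite ler_wpM2r//; [lra|have := sqr_ge0 K; lra].
have NLe : N%:R * L <= expR (L / 4).
  by rewrite -ler_ln ?posrE ?expR_gt0 ?expRK -/W ?(ltW h)//; lra.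
have TE : expR (L / 2) * expR (L / 2) = T%:R.
  by rewrite -expRD -(_ : L = L / 2 + L / 2) ?lnK ?posrE//; field.
have EE : expR (L / 4) * expR (L / 4) = expR (L / 2).
  by rewrite -expRD; congr expR; field.
have KE : K <= expR (L / 2).
  rewrite -(ler_sqr (ltW K0) (expR_ge0 _)) [leRHS]expr2 TE.
  by apply: le_trans (_ : K3 <= _); [lra|apply: le_trans hTN; nra].
rewrite -TE -mulrA; apply: ler_pM => //; first exact: ltW.
  by rewrite mulr_ge0 ?sqr_ge0//; lra.
rewrite -EE; apply: (@le_trans _ _ ((N%:R * L) * (N%:R * L))).
  have -> : N%:R * L * (N%:R * L) = N%:R * (N%:R * L ^+ 2) by ring.
  by rewrite ler_peMl ?mulr_ge0 ?sqr_ge0//; lra.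
by apply: ler_pM => //; lra.
Qed.

Lemma inv_le_sqrt_ratio N T : (0 < N)%N -> (0 < T)%N ->
  T%:R^-1 <= Num.sqrt (N%:R / T%:R) :> R.
Proof.
move=> N0 T0; have TR : 0 < T%:R :> R by rewrite ltr0n.
rewrite -[leLHS]ger0_norm ?invr_ge0// -sqrtr_sqr ler_sqrt ?divr_ge0//.
rewrite expr2 ler_pM2r ?invr_gt0//.
by rewrite (@le_trans _ _ 1) ?invf_le1// ler1n.
Qed.

End Numerics.

(** * The model as a linear chain near its mean field *)

Section Model.
Context {R : realType} {N : nat}.
Variables (lam mu p : R) (Pp : {set 'I_N}) (a : 'M[bool]_N).
Hypothesis N0 : (0 < N)%N.
Hypothesis lam01 : 0 < lam < 1.
Hypothesis p01 : 0 < p <= 1.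
Hypothesis mu_lam : 0 < mu <= lam.
Local Notation S := {ffun 'I_N -> bool}.

Definition spin (j : 'I_N) : R := if j \in Pp then 1 else -1.

Definition interaction (i j : 'I_N) : R := (1 - lam) / N%:R * spin j * (a i j)%:R.

Definition base_rate (i : 'I_N) : R :=
  mu + (1 - lam) * (N%:R^-1 * \sum_(j in ~: Pp) (a i j)%:R).

Definition frac (V : {set 'I_N}) : R := #|V|%:R / N%:R.

Let NR : 0 < N%:R :> R. Proof. by rewrite ltr0n. Qed.

Lemma sum_spin (F : 'I_N -> R) :
  \sum_j spin j * F j = \sum_(j in Pp) F j - \sum_(j in ~: Pp) F j.
Proof.
rewrite (bigID (mem Pp))/= -sumrN; congr (_ + _).
  by apply: eq_bigr => j jP; rewrite /spin jP mul1r.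
by apply: eq_big => j; rewrite ?inE // => /negPf jP; rewrite /spin jP mulN1r.
Qed.

Lemma sum_split (F : 'I_N -> R) :
  \sum_j F j = \sum_(j in Pp) F j + \sum_(j in ~: Pp) F j.
Proof.
by rewrite (bigID (mem Pp))/=; congr (_ + _); apply: eq_bigl => j; rewrite inE.
Qed.

Lemma spin_prob_linear (x : S) i :
  spin_prob lam mu Pp a i x = lin_prob base_rate interaction x i.
Proof.
rewrite /spin_prob /lin_prob /base_rate.
have -> : \sum_j interaction i j * (x j)%:R =
    (1 - lam) / N%:R * \sum_j spin j * ((a i j)%:R * (x j)%:R).
  by rewrite mulr_sumr; apply: eq_bigr => j _; rewrite /interaction; ring.
rewrite sum_spin.
have -> : \sum_(j in ~: Pp) (a i j)%:R * (1 - (x j)%:R) =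
    \sum_(j in ~: Pp) (a i j)%:R - \sum_(j in ~: Pp) (a i j)%:R * (x j)%:R :> R.
  by rewrite -sumrB; apply: eq_bigr => j _; ring.
by ring.
Qed.

Lemma frac_sum : frac Pp + frac (~: Pp) = 1.
Proof. by rewrite /frac -mulrDl -natrD cardsC card_ord divff// gt_eqF. Qed.

Lemma lin_prob01 (x : S) i : 0 <= lin_prob base_rate interaction x i <= 1.
Proof.
rewrite -spin_prob_linear /spin_prob.
have /andP[l0 l1] := lam01; have /andP[m0 m1] := mu_lam.
set s1 := \sum_(j in Pp) _; set s2 := \sum_(j in ~: Pp) _.
have s10 : 0 <= s1 by apply: sumr_ge0 => j _; rewrite mulr_ge0.
have s11 : s1 <= #|Pp|%:R.
  by rewrite -sumr_const; apply: ler_sum => j _; case: (a i j) (x j) => [] []; rewrite /= ?mulr1 ?mulr0 ?mul0r.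
have s20 : 0 <= s2 by apply: sumr_ge0 => j _; rewrite mulr_ge0 ?subr_ge0; case: (x j).
have s21 : s2 <= #|~: Pp|%:R.
  by rewrite -sumr_const; apply: ler_sum => j _; case: (a i j) (x j) => [] []; rewrite /= ?subrr ?subr0 ?mulr1 ?mulr0 ?mul0r.
have h0 : 0 <= N%:R^-1 * s1 + N%:R^-1 * s2 by rewrite addr_ge0 ?mulr_ge0 ?invr_ge0.
have h1 : N%:R^-1 * s1 + N%:R^-1 * s2 <= 1.
  by rewrite -[leRHS]frac_sum /frac; apply: lerD; rewrite mulrC ler_wpM2r ?invr_ge0.
apply/andP; split; first by rewrite addr_ge0 ?mulr_ge0//; lra.
have : (1 - lam) * (N%:R^-1 * s1 + N%:R^-1 * s2) <= 1 - lam.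
  by rewrite ler_piMr//; lra.
lra.
Qed.

Lemma spin_norm j : `|spin j| = 1.
Proof. by rewrite /spin; case: ifP; rewrite ?normrN normr1. Qed.

Lemma interaction_small i j : `|interaction i j| <= (1 - lam) / N%:R.
Proof.
have /andP[l0 l1] := lam01.
have c0 : 0 <= (1 - lam) / N%:R by rewrite divr_ge0 ?subr_ge0 ?ltW.
rewrite /interaction !normrM spin_norm mulr1 -normrM ger0_norm//.
by rewrite ler_piMr//; case: (a i j); rewrite /= ?normr1 ?normr0.
Qed.

Variable del : R.
Let av (g : 'I_N -> 'I_N * 'I_N) V : R := avg_over g V [ffun ij => a ij.1 ij.2].
Hypothesis balP : balanced p del Pp [ffun ij => a ij.1 ij.2].
Hypothesis balM : balanced p del (~: Pp) [ffun ij => a ij.1 ij.2].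

Let al := (1 - lam) * p.
Let rho := frac Pp - frac (~: Pp).

Let avr i V : av (rows i) V = N%:R^-1 * \sum_(j in V) (a i j)%:R.
Proof. by congr (_ * _); apply: eq_bigr => j _; rewrite ffunE. Qed.

Let avc j V : av (cols j) V = N%:R^-1 * \sum_(i in V) (a i j)%:R.
Proof. by congr (_ * _); apply: eq_bigr => i _; rewrite ffunE. Qed.

Let bal i : [/\ `|av (rows i) Pp - p * frac Pp| <= del, `|av (rows i) (~: Pp) - p * frac (~: Pp)| <= del,
  `|av (cols i) Pp - p * frac Pp| <= del & `|av (cols i) (~: Pp) - p * frac (~: Pp)| <= del].
Proof. by move/forallP/(_ i)/andP: balP => [? ?]; move/forallP/(_ i)/andP: balM => [? ?]. Qed.

Let two_close (x y u v c : R) : `|x - u| <= del -> `|y - v| <= del -> `|c| <= 1 ->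
  `|(1 - lam) * c * (x - y) - (1 - lam) * c * (u - v)| <= 2 * del /\
  `|(1 - lam) * c * (x + y) - (1 - lam) * c * (u + v)| <= 2 * del.
Proof.
move=> h1 h2 c1; have /andP[l0 l1] := lam01.
have k1 : `|(1 - lam) * c| <= 1 by rewrite normrM mulr_ile1// ger0_norm; lra.
have fin (t : R) : `|t| <= 2 * del -> `|(1 - lam) * c * t| <= 2 * del.
  by move=> ht; rewrite normrM -[leRHS]mul1r; apply: ler_pM.
split; rewrite -mulrBr; apply: fin.
  have -> : x - y - (u - v) = (x - u) - (y - v) by ring.
  by apply: le_trans (ler_normB _ _) _; lra.
have -> : x + y - (u + v) = (x - u) + (y - v) by ring.
by apply: le_trans (ler_normD _ _) _; lra.
Qed.

Lemma base_rate_close i : `|base_rate i - (mu + al * frac (~: Pp))| <= del.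
Proof.
have /andP[l0 l1] := lam01; have [_ h _ _] := bal i.
have -> : base_rate i - (mu + al * frac (~: Pp)) =
    (1 - lam) * (av (rows i) (~: Pp) - p * frac (~: Pp)).
  by rewrite /base_rate avr /al; ring.
by rewrite normrM -[leRHS]mul1r; apply: ler_pM => //; rewrite ger0_norm; lra.
Qed.

Lemma row_sum_close i : `|\sum_j interaction i j - al * rho| <= 2 * del.
Proof.
have [h1 h2 _ _] := bal i; have := (two_close h1 h2 (_ : `|1| <= 1)).1.
rewrite normr1 => /(_ (lexx _)).
have -> : (1 - lam) * 1 * (p * frac Pp - p * frac (~: Pp)) = al * rho by rewrite /al /rho; ring.
have <- // : \sum_j interaction i j = (1 - lam) * 1 * (av (rows i) Pp - av (rows i) (~: Pp)).
transitivity ((1 - lam) / N%:R * \sum_j spin j * (a i j)%:R).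
  by rewrite mulr_sumr; apply: eq_bigr => j _; rewrite /interaction; ring.
by rewrite sum_spin !avr; ring.
Qed.

Lemma row_spin_sum_close i : `|\sum_j interaction i j * spin j - al| <= 2 * del.
Proof.
have [h1 h2 _ _] := bal i; have := (two_close h1 h2 (_ : `|1| <= 1)).2.
rewrite normr1 => /(_ (lexx _)).
have -> : (1 - lam) * 1 * (p * frac Pp + p * frac (~: Pp)) = al.
  by rewrite -mulrDr frac_sum /al; ring.
have <- // : \sum_j interaction i j * spin j = (1 - lam) * 1 * (av (rows i) Pp + av (rows i) (~: Pp)).
transitivity ((1 - lam) / N%:R * \sum_j (a i j)%:R).
  rewrite mulr_sumr; apply: eq_bigr => j _; rewrite /interaction /spin.
  by case: ifP => _; ring.
by rewrite sum_split !avr; ring.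
Qed.

Lemma col_spin_sum_close j :
  `|\sum_i interaction i j * spin i - al * rho * spin j| <= 2 * del.
Proof.
have s1 : `|spin j| <= 1 by rewrite spin_norm.
have [_ _ h1 h2] := bal j; have := (two_close h1 h2 s1).1.
have -> : (1 - lam) * spin j * (p * frac Pp - p * frac (~: Pp)) = al * rho * spin j.
  by rewrite /al /rho; ring.
have <- // : \sum_i interaction i j * spin i = (1 - lam) * spin j * (av (cols j) Pp - av (cols j) (~: Pp)).
transitivity ((1 - lam) / N%:R * spin j * \sum_i spin i * (a i j)%:R).
  by rewrite mulr_sumr; apply: eq_bigr => i _; rewrite /interaction; ring.
by rewrite sum_spin !avc; ring.
Qed.

Lemma col_sum_close j : `|\sum_i interaction i j - al * spin j| <= 2 * del.
Proof.
have s1 : `|spin j| <= 1 by rewrite spin_norm.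
have [_ _ h1 h2] := bal j; have := (two_close h1 h2 s1).2.
have -> : (1 - lam) * spin j * (p * frac Pp + p * frac (~: Pp)) = al * spin j.
  by rewrite -mulrDr frac_sum /al; ring.
have <- // : \sum_i interaction i j = (1 - lam) * spin j * (av (cols j) Pp + av (cols j) (~: Pp)).
transitivity ((1 - lam) / N%:R * spin j * \sum_i (a i j)%:R).
  by rewrite mulr_sumr; apply: eq_bigr => i _; rewrite /interaction; ring.
by rewrite sum_split !avc; ring.
Qed.

Let rho1 : `|rho| <= 1.
Proof.
have f0 V : 0 <= frac V by rewrite divr_ge0.
have := f0 Pp; have := f0 (~: Pp); have := frac_sum.
by rewrite /rho ler_norml => *; apply/andP; split; lra.
Qed.

Let al01 : 0 < al <= 1 - lam.
Proof.
have /andP[l0 l1] := lam01; have /andP[p0 p1] := p01.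
by rewrite /al mulr_gt0 ?ler_piMr ?subr_ge0 ?subr_gt0// ltW.
Qed.

Let alrho : `|al * rho| <= 1 - lam.
Proof.
have /andP[a0 a1] := al01.
by rewrite normrM (gtr0_norm a0) -[leRHS]mulr1; apply: ler_pM => //; exact: ltW.
Qed.

Let m0 := (mu + al * frac (~: Pp)) / (1 - al * rho).

(* The limiting variance: d = m0 (1 - m0) with m0 the mean-field density. *)
Lemma limit_variance_ge (r0 : R) : 0 < r0 -> r0 <= frac Pp -> r0 <= frac (~: Pp) ->
  [/\ 0 <= m0 <= 1, m0 = (mu + al * frac (~: Pp)) + al * rho * m0 &
      al * (1 - lam) * r0 ^+ 2 / 4 <= m0 * (1 - m0)].
Proof.
move=> r00 rP rM; have /andP[l0 l1] := lam01; have /andP[a0 a1] := al01.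
have /andP[mu0 mu1] := mu_lam.
have := alrho; rewrite ler_norml => /andP[ar1 ar2].
have den0 : 0 < 1 - al * rho by lra.
have den2 : 1 - al * rho <= 2 by lra.
have fs := frac_sum.
have m0E : 1 - m0 = (1 - mu - al * frac Pp) / (1 - al * rho).
  rewrite /m0 -{1}(divff (lt0r_neq0 den0)) -mulrBl; congr (_ / _).
  by rewrite /rho; ring.
(* The numerators of m0 and 1 - m0 are bounded below uniformly in mu: al r0 remains after dropping
   mu, and (1 - lam) r0 remains because mu <= lam. *)
have alP : al * frac Pp <= (1 - lam) * (1 - r0).
  by apply: ler_pM; lra.
have num2 : (1 - lam) * r0 <= 1 - mu - al * frac Pp by lra.
have num1 : al * r0 <= mu + al * frac (~: Pp).
  have := ler_wpM2l (ltW a0) rM; lra.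
have b1 : 0 <= al * r0 by rewrite mulr_ge0 ?ltW.
have b2 : 0 <= (1 - lam) * r0 by rewrite mulr_ge0 ?ltW ?subr_gt0.
have half (x y : R) : 0 <= x -> x <= y -> x / 2 <= y / (1 - al * rho).
  by move=> x0 xy; apply: ler_pM => //; rewrite ?invr_ge0// lef_pV2 ?posrE.
have h1 := half _ _ b1 num1; have h2 := half _ _ b2 num2.
split.
- have : 0 <= m0 by apply: le_trans h1; rewrite divr_ge0.
  have : 0 <= 1 - m0 by rewrite m0E; apply: le_trans h2; rewrite divr_ge0.
  by move=> ? ?; apply/andP; split; lra.
- by rewrite /m0; field; rewrite gt_eqF.
- rewrite m0E; have -> : al * (1 - lam) * r0 ^+ 2 / 4 = (al * r0 / 2) * ((1 - lam) * r0 / 2).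
    by field.
  by apply: ler_pM => //; rewrite divr_ge0.
Qed.

Let d := m0 * (1 - m0).
Let kap := al ^+ 2 * rho * d / (1 - (al * rho) ^+ 2).

Lemma kap_fixpoint : kap = al * rho * (d * al + kap * (al * rho)).
Proof.
have /andP[l0 l1] := lam01.
have h : (al * rho) ^+ 2 < 1.
  rewrite -[_ ^+ 2]real_normK ?num_real// expr_lt1//; apply: le_lt_trans alrho _; lra.
by rewrite /kap; field; rewrite gt_eqF// subr_gt0.
Qed.

Section Stationary.
Variable pi : S -> R.
Hypothesis pi_ge0 : forall x, 0 <= pi x.
Hypothesis pi_sum1 : \sum_x pi x = 1.
Local Notation q := (lin_prob base_rate interaction).
Hypothesis pi_step : forall f, statE pi (step q f) = statE pi f.

Lemma signal_close (r0 : R) j : 0 < r0 -> r0 <= frac Pp -> r0 <= frac (~: Pp) ->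
  1 <= N%:R * del ->
  `|\sum_i cov pi j i * colsum interaction i - (al * d * spin j + al * kap)|
    <= 12 * del / lam ^+ 2.
Proof.
move=> r00 rP rM Ndel; have /andP[a0 a1] := al01.
have [m01 m0f _] := limit_variance_ge r00 rP rM.
apply: (@cov_colsum_close _ _ lam interaction (cov pi) base_rate (stat_mean pi) spin
  al rho (mu + al * frac (~: Pp)) m0 kap del) => //.
- exact: interaction_small.
- by move=> i; exact: stat_mean_fixpoint.
- exact: stat_mean01.
- by move=> i k ik; exact: cov_offdiag.
- by move=> k; exact: cov_diag.
- exact: (cov_row_sum lam01 N0 interaction_small pi_ge0 pi_sum1 pi_step).
- exact: spin_norm.
- by rewrite ltW.
- exact: kap_fixpoint.
- exact: base_rate_close.
- exact: row_sum_close.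
- exact: row_spin_sum_close.
- exact: col_spin_sum_close.
- exact: col_sum_close.
Qed.

End Stationary.
End Model.

Lemma expR_Nln2 (R : realType) T (x : R) : (0 < T)%N -> 2 * ln T%:R <= x ->
  2 * expR (- x) <= 2 / T%:R ^+ 2.
Proof.
move=> T0 hx; have TR : 0 < T%:R :> R by rewrite ltr0n.
have -> : T%:R ^+ 2 = expR (2 * ln T%:R) :> R.
  by rewrite mulr_natl mulr2n expRD lnK ?posrE// expr2.
by rewrite -expRN ler_pM2l// ler_expR lerN2.
Qed.

Lemma sigma_ag_noise_prob (R : realType) N (lam : R) (b : 'I_N -> R)
    (A : 'I_N -> 'I_N -> R) (pi : {ffun 'I_N -> bool} -> R) (z : R) T :
  0 < lam < 1 -> (0 < N)%N -> (forall i j, `|A i j| <= (1 - lam) / N%:R) ->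
  (forall x i, 0 <= lin_prob b A x i <= 1) -> (forall x, 0 <= pi x) ->
  \sum_x pi x = 1 ->
  (forall f, statE pi (step (lin_prob b A) f) = statE pi f) ->
  0 < z -> (2 <= T)%N -> 2^-1 <= ln T%:R :> R -> 2 * N%:R <= T%:R :> R ->
  2 / z <= T%:R -> 11808 / (lam ^+ 4 * z ^+ 2) * N%:R * ln T%:R ^+ 2 <= T%:R ->
  pathE (lin_prob b A) pi T (fun s => (~~ [forall j,
    `|sigma_ag (path_sample s) T j 0 - \sum_i cov pi j i * colsum A i| <= 3 * z])%:R)
  <= 4 / T%:R.
Proof.
move=> lam01 N0 A_small q01 pi_ge0 pi_sum1 pi_step z0 T2 L1 NT zT.
have /andP[l0 l1] := lam01; set L := ln T%:R in L1 *.
have T0 : (0 < T)%N by exact: leq_trans T2.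
have TR : 0 < T%:R :> R by rewrite ltr0n.
have NR : 1 <= N%:R :> R by rewrite ler1n.
have NR0 : 0 < N%:R :> R by rewrite ltr0n.
have L0 : 0 < L by lra.
(* B makes lam B^2 / (16 N) = 2 L, so that each truncation failure has probability at most 2/T^2. V
   bounds the budget: N <= 2 N L / lam gives 27 * 2 + 6 * 32 = 246. Requiring the other tail to be
   2/T^2 too yields 11808 = 2 * 24 * 246. *)
pose B := Num.sqrt (32 * N%:R * L / lam).
pose V := 246 * N%:R * L / lam ^+ 3.
have x0 : 0 < 32 * N%:R * L / lam by rewrite divr_gt0// mulr_gt0// mulr_gt0.
have B0 : 0 < B by rewrite sqrtr_gt0.
have B2 : B ^+ 2 = 32 * N%:R * L / lam by rewrite sqr_sqrtr// ltW.
have V0 : 0 < V.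
  apply: divr_gt0; last exact: exprn_gt0.
  by apply: mulr_gt0 => //; apply: mulr_gt0; rewrite ?ltr0n.
have NL : N%:R <= 2 * N%:R * L / lam.
  rewrite ler_pdivlMr// -[2 * N%:R * L]mulrAC [2 * L * _]mulrC ler_pM2l//; lra.
have hV : (27 * N%:R + 6 * B ^+ 2) / lam ^+ 2 <= V.
  have -> : V = (246 * N%:R * L / lam) / lam ^+ 2 by rewrite /V; field; rewrite gt_eqF.
  rewrite ler_pM2r ?invr_gt0 ?exprn_gt0// B2; lra.
move=> KT; have V24 : 0 < 24 * V by rewrite pmulr_rgt0.
have e1 : 2 * expR (- (lam * z ^+ 2 * T%:R / (24 * V))) <= 2 / T%:R ^+ 2.
  apply: expR_Nln2 => //; rewrite -/L ler_pdivlMr//.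
  have -> : 2 * L * (24 * V) = (lam * z ^+ 2) * (11808 / (lam ^+ 4 * z ^+ 2) * N%:R * L ^+ 2).
    by rewrite /V; field; rewrite !gt_eqF.
  by rewrite ler_pM2l// mulr_gt0// exprn_gt0.
clear KT; have e2 : 2 * expR (- (lam * B ^+ 2 / (16 * N%:R))) <= 2 / T%:R ^+ 2.
  apply: expR_Nln2 => //; rewrite -/L B2 le_eqVlt; apply/orP; left; apply/eqP.
  by field; rewrite !gt_eqF.
have := sigma_ag_noise lam01 N0 A_small q01 pi_ge0 pi_sum1 pi_step T0 z0 B0 V0 hV e1 e2.
have N2 : N%:R * (2 / T%:R ^+ 2) <= z.
  have -> : N%:R * (2 / T%:R ^+ 2) = (2 * N%:R) / T%:R / T%:R :> R by field; rewrite gt_eqF.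
  rewrite ler_pdivrMr// ler_pdivrMr//.
  apply: le_trans NT _; rewrite -[leLHS]mul1r; apply: ler_wpM2r; first exact: ltW.
  by move: zT; rewrite ler_pdivrMr// => ?; lra.
move=> h; apply: le_trans (le_trans _ h) _.
  apply: le_pathE => // s.
  have [H|_] := boolP [forall j, `|sigma_ag (path_sample s) T j 0 -
      \sum_i cov pi j i * colsum A i| <= 2 * z + N%:R * (2 / T%:R ^+ 2)].
    rewrite (_ : [forall j, _ <= 3 * z]) //; apply/forallP => j.
    by apply: le_trans (forallP H j) _; lra.
  by case: [forall j, _].
have -> : N.+1%:R * (2 / T%:R ^+ 2) + T%:R * (2 / T%:R ^+ 2) = 2 * (N.+1%:R + T%:R) / T%:R / T%:R :> R.
  by field; rewrite gt_eqF.
rewrite ler_pM2r ?invr_gt0// ler_pdivrMr//.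
rewrite -natr1; lra.
Qed.

Lemma eq_sigma_ag (R : realType) N (x y : nat -> 'cV[R]_N) T :
  (forall t, (1 <= t <= T.+1)%N -> x t = y t) -> sigma_ag x T = sigma_ag y T.
Proof.
move=> xy.
have E : mean_hat x T = mean_hat y T.
  congr (_ *: _); apply: eq_big_nat => t /andP[t1 tT].
  by rewrite xy// t1 (ltnW tT).
congr (_ ^T *m _); rewrite /Sigma1_hat E; congr (_ *: _).
apply: eq_big_nat => t /andP[t1 tT].
by rewrite !xy ?t1 ?(ltnW tT)//= ltnS -ltnS.
Qed.

Lemma eq_path_sample (R : realType) N (s s' : nat -> {ffun 'I_N -> bool}) T :
  (forall k, (k <= T)%N -> s k = s' k) ->
  sigma_ag (@path_sample R N s) T = sigma_ag (path_sample s') T.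
Proof.
move=> ss'; apply: eq_sigma_ag => -[//|t] /andP[_ tT].
by apply/matrixP => i j; rewrite !mxE /= ss'.
Qed.

Lemma sample_path (R : realType) N d (Omega : measurableType d) (P : probability Omega R)
    (X : int -> 'I_N -> {RV P >-> bool}) w T :
  sigma_ag (sample X w) T = sigma_ag (path_sample (path X w)) T.
Proof.
apply: eq_sigma_ag => -[//|t] _; apply/matrixP => i j.
by rewrite !mxE ffunE /= -PoszD add1n.
Qed.

(** * Exact recovery and the final probability bound *)

Section Recovery.
Context {R : realType}.
Variables (lam p r0 : R).
Hypotheses (lam01 : 0 < lam < 1) (p01 : 0 < p <= 1) (r00 : 0 < r0).

(* g_min bounds from below half the gap between the two values around which
   the entries of sigma_ag concentrate. *)
Definition g_min : R := ((1 - lam) * p) ^+ 2 * (1 - lam) * r0 ^+ 2 / 4.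
(** The largest sup error that the separation condition 4E <= g r admits for g = [g_min]. One half
    is spent on the environment, 12 * env_tol / lam^2, and one half on the noise, 3 * noise_tol. *)
Definition tolerance : R := g_min * r0 / 4.
Definition env_tol : R := lam ^+ 2 * tolerance / 24.
Definition noise_tol : R := tolerance / 6.

Lemma tolerance_gt0 : 0 < tolerance.
Proof.
have /andP[l0 l1] := lam01; have /andP[p0 _] := p01.
have l1' : 0 < 1 - lam by lra.
by rewrite /tolerance /g_min !(divr_gt0, mulr_gt0, exprn_gt0).
Qed.

Lemma env_tol_gt0 : 0 < env_tol.
Proof.
have /andP[l0 _] := lam01.
by rewrite /env_tol divr_gt0// mulr_gt0 ?exprn_gt0// tolerance_gt0.
Qed.

Lemma noise_tol_gt0 : 0 < noise_tol.
Proof. by rewrite /noise_tol divr_gt0// tolerance_gt0. Qed.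

Section FixedEnvironment.
Variables (N : nat) (mu : R) (Pp : {set 'I_N}) (a : 'M[bool]_N).
Hypothesis N0 : (0 < N)%N.
Hypothesis mu_lam : 0 < mu <= lam.
Hypotheses (fP : r0 <= @frac R N Pp) (fM : r0 <= @frac R N (~: Pp)).
Hypothesis balP : balanced p env_tol Pp [ffun ij => a ij.1 ij.2].
Hypothesis balM : balanced p env_tol (~: Pp) [ffun ij => a ij.1 ij.2].
Hypothesis Ndel : 1 <= N%:R * env_tol.
Local Notation b := (base_rate lam mu Pp a).
Local Notation A := (interaction lam Pp a).
Variable pi : {ffun 'I_N -> bool} -> R.
Hypothesis pi_ge0 : forall x, 0 <= pi x.
Hypothesis pi_sum1 : \sum_x pi x = 1.
Hypothesis pi_step : forall f, statE pi (step (lin_prob b A) f) = statE pi f.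

Lemma recovery (v : 'cV[R]_N) meth S :
  (forall j, `|v j 0 - \sum_i cov pi j i * colsum A i| <= 3 * noise_tol) ->
  is_clustering meth v S -> S = Pp.
Proof.
move=> hv; have /andP[l0 l1] := lam01; have /andP[p0 _] := p01.
have NR0 : 0 < N%:R :> R by rewrite ltr0n.
set al := (1 - lam) * p; have al0 : 0 < al by rewrite mulr_gt0// subr_gt0.
pose m0 := (mu + al * frac (~: Pp)) / (1 - al * (frac Pp - frac (~: Pp))).
have [_ _] := limit_variance_ge N0 lam01 p01 mu_lam r00 fP fM; rewrite -/al -/m0 => hd.
set kap := al ^+ 2 * (frac Pp - frac (~: Pp)) * (m0 * (1 - m0)) / (1 - (al * (frac Pp - frac (~: Pp))) ^+ 2).
have dg : g_min <= al * (m0 * (1 - m0)).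
  have -> : g_min = al * (al * (1 - lam) * r0 ^+ 2 / 4) by rewrite /g_min -/al; ring.
  by rewrite ler_pM2l.
have tol0 := tolerance_gt0.
have gm0 : 0 < g_min by move: tol0; rewrite /tolerance -mulrA pmulr_lgt0// divr_gt0.
have close j : `|v j 0 - (al * (m0 * (1 - m0)) * spin Pp j + al * kap)| <= tolerance.
  have h := signal_close N0 lam01 p01 mu_lam balP balM pi_ge0 pi_sum1 pi_step j r00 fP fM Ndel.
  have h' := hv j.
  rewrite -(subrKA (\sum_i cov pi j i * colsum A i)).
  apply: le_trans (ler_normD _ _) _.
  have -> : tolerance = 3 * noise_tol + 12 * env_tol / lam ^+ 2.
    by rewrite /noise_tol /env_tol; field; rewrite gt_eqF.
  exact: lerD.
apply: (@clustering_separated R N v Pp (al * (m0 * (1 - m0))) (al * kap) tolerance r0) => //.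
- exact: lt_le_trans dg.
- exact: ltW.
- rewrite /tolerance; have -> : 4 * (g_min * r0 / 4) = g_min * r0 by field.
  by rewrite ler_pM2r.
- by move=> i iP; have := close i; rewrite /spin iP mulr1 [al * kap + _]addrC.
- by move=> i /negPf iP; have := close i; rewrite /spin iP mulrN1 [al * kap + _]addrC.
- by rewrite -ler_pdivlMr.
- by rewrite -ler_pdivlMr.
Qed.

End FixedEnvironment.
End Recovery.

Theorem theorem2p9 (R : realType) (K0 lambda p rplus rminus : R)
    (hlambda : 0 < lambda < 1) (hp : 0 < p <= 1)
    (hrplus : 0 < rplus < 1) (hrminus : 0 < rminus < 1)
    (hr : rplus + rminus = 1) :
  exists (N0 : nat) (K1 K2 K3 : R),
    [/\ 0 < K1, 0 < K2, 0 < K3 &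
    forall (mu : R) (N T : nat) (Pplus : {set 'I_N})
      (d : measure_display) (Omega : measurableType d)
      (P : probability Omega R)
      (theta : 'I_N * 'I_N -> {RV P >-> bool})
      (X : int -> 'I_N -> {RV P >-> bool})
      (b : clustering_method) (Phat : Omega -> {set 'I_N}),
    0 < mu <= lambda ->
    Num.max `|#|Pplus|%:R / N%:R - rplus| `|#|~: Pplus|%:R / N%:R - rminus|
      <= K0 * N%:R^-1 ->
    binary_graphical_model lambda mu p Pplus theta X ->
    (forall S : {set 'I_N}, measurable (Phat @^-1` [set S])) ->
    (forall w : Omega, is_clustering b (sigma_ag (sample X w) T) (Phat w)) ->
    (N0 <= N)%N ->
    Num.max (K3 * N%:R * ln T%:R * ln (N%:R * ln T%:R)) 2 <= T%:R ->
    (P [set w | (K1 * (N%:R * ln T%:R * ln (N%:R * ln T%:R) / T%:R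
                      + ln N%:R / N%:R)
                <= misclassification_rate Pplus (Phat w))%R]
     <= (K2 * (Num.sqrt (N%:R / T%:R) + N%:R^-1))%:E)%E].
Proof.
have /andP[rp0 _] := hrplus; have /andP[rm0 _] := hrminus.
have /andP[l0 l1] := hlambda.
(* The halving leaves room for the deviation K0/N of the community proportions, at most r0 for large
   N. *)
pose r0 := Num.min rplus rminus / 2.
have min0 : 0 < Num.min rplus rminus by rewrite lt_min rp0.
have r00 : 0 < r0 by rewrite divr_gt0.
pose del := env_tol lambda p r0; pose z := noise_tol lambda p r0.
have del0 : 0 < del by exact: env_tol_gt0.
have z0 : 0 < z by exact: noise_tol_gt0.
pose Kc := 11808 / (lambda ^+ 4 * z ^+ 2).
have Kc0 : 0 < Kc.
  by apply: divr_gt0; [rewrite ltr0n|apply: mulr_gt0; apply: exprn_gt0].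
have KcE : Kc = 11808 / (lambda ^+ 4 * z ^+ 2) by [].
pose c4 := 1024 / del ^+ 4.
have c40 : 0 < c4 by apply: divr_gt0; [rewrite ltr0n|apply: exprn_gt0].
have c4E : c4 = 1024 / del ^+ 4 by [].
clearbody Kc c4.
pose K3 := 4 + 4 * Kc + Kc ^+ 2 + 2 / z.
have zi : 0 < 2 / z by rewrite divr_gt0.
(* The summands of N0 serve [sample_size_bounds], K0/N <= r0 and N del >= 1. In K2, c4 pays for
   unbalanced environments (twice 512/del^4) and 4 for the noise. *)
exists (8 + Num.bound (`|K0| / r0) + Num.bound del^-1)%N, 1, (c4 + 4), K3.
split; first exact: ltr01.
- by apply: addr_gt0.
- by have := sqr_ge0 Kc; rewrite /K3; lra.
move=> mu N T Pp d Omega P theta X meth Phat hmu hfrac [[indep law] model] mPhat hclust hN.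
rewrite ge_max => /andP[hT hT2].
have N8 : (8 <= N)%N by rewrite (leq_trans _ hN)// -addnA leq_addr.
have N0 : (0 < N)%N by exact: leq_trans N8.
have T2 : (2 <= T)%N by rewrite -(ler_nat R).
have T0 : (0 < T)%N by exact: leq_trans T2.
have NR : 0 < N%:R :> R by rewrite ltr0n.
have TR : 0 < T%:R :> R by rewrite ltr0n.
have K3' : 4 + 4 * Kc + Kc ^+ 2 <= K3 by rewrite /K3 lerDl ltW.
have [L1 W0 NT KT KcT] := sample_size_bounds Kc0 K3' N8 T2 hT.
have zT : 2 / z <= T%:R by apply: le_trans KT; rewrite /K3; have := sqr_ge0 Kc; lra.
have Nbound x : 0 <= x -> (Num.bound x <= N)%N -> x <= N%:R :> R.
  move=> x0 xN; apply: le_trans (_ : (Num.bound x)%:R <= _); last by rewrite ler_nat.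
  by apply: ltW; apply: archi_boundP.
have hfr : K0 * N%:R^-1 <= r0.
  rewrite ler_pdivrMr// mulrC -ler_pdivrMr//.
  apply: (@le_trans _ _ (`|K0| / r0)); first by rewrite ler_pM2r ?invr_gt0// ler_norm.
  apply: Nbound; first by rewrite divr_ge0// ltW.
  by apply: leq_trans hN; rewrite addnAC leq_addl.
have Ndel : 1 <= N%:R * del.
  rewrite -ler_pdivrMr// div1r; apply: Nbound; first by rewrite invr_ge0 ltW.
  by apply: leq_trans hN; rewrite leq_addl.
move: hfrac; rewrite ge_max => /andP[hfP hfM].
have rmin (r : R) (V : {set 'I_N}) : Num.min rplus rminus <= r ->
    `|#|V|%:R / N%:R - r| <= K0 * N%:R^-1 -> r0 <= frac V.
  move=> hr0 /le_trans/(_ hfr); rewrite ler_norml => /andP[h _].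
  have : Num.min rplus rminus = 2 * r0 by rewrite /r0; field.
  rewrite /frac; lra.
have fP : r0 <= @frac R N Pp by apply: rmin hfP; rewrite ge_min lexx.
have fM : r0 <= @frac R N (~: Pp) by apply: rmin hfM; rewrite ge_min lexx orbT.
pose env (a : {ffun 'I_N * 'I_N -> bool}) : set Omega :=
  [set w | [ffun ij => theta ij w] = a].
have mat_env (a : {ffun 'I_N * 'I_N -> bool}) :
    environment_event theta (\matrix_(i, j) a (i, j)) = env a.
  apply/seteqP; split => w /=; rewrite /environment_event /env /=.
    by move=> H; apply/ffunP => -[i j]; rewrite ffunE H mxE.
  by move=> <- i j; rewrite mxE ffunE.
have p01 : 0 <= p <= 1 by case/andP: hp => /ltW -> ->.
pose good (a : {ffun 'I_N * 'I_N -> bool}) := balanced p del Pp a && balanced p del (~: Pp) a.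
set M := [set w | _].
have mM : measurable M.
  exact: (measurable_preimage_fin (fun S => _ <= misclassification_rate Pp S) mPhat).
have menv a : measurable (env a) by exact: measurable_ffun_eq.
(* An unbalanced environment is charged its whole weight, a balanced one only the noise probability
   4/T. *)
have prM a : pr P (M `&` env a) <= bern_weight (fun=> p) a * ((~~ good a)%:R + 4 / T%:R).
  have pra : pr P (env a) = bern_weight (fun=> p) a by exact: pr_iid_bernoulli.
  rewrite -pra.
  have mMa : measurable (M `&` env a) by exact: measurableI.
  have le_env : pr P (M `&` env a) <= pr P (env a) by apply: le_pr.
  have T4 : 0 <= 4 / T%:R :> R by rewrite divr_ge0.
  case: (boolP (good a)) => [/andP[gP gM]|_]; last first.
    by apply: le_trans le_env _; rewrite ler_peMr ?pr_ge0// lerDl.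
  rewrite add0r.
  (* Null environments occur when p = 1; the model makes no assumption on them, and they contribute
     nothing. *)
  have [E0|E0] := eqVneq (P (env a)) 0%E.
    have E00 : pr P (env a) = 0 by rewrite /pr E0.
    by rewrite E00 mul0r -E00.
  pose am : 'M[bool]_N := \matrix_(i, j) a (i, j).
  have aE : [ffun ij => am ij.1 ij.2] = a.
    by apply/ffunP => -[i j]; rewrite ffunE mxE.
  have [stat mark] : cond_stationary X (env a) /\
      cond_markov X (env a) (transition lambda mu Pp am).
    by rewrite -mat_env; apply: model; rewrite mat_env.
  have Q_lin : transition lambda mu Pp am =
      (fun x y => bern_weight (lin_prob (base_rate lambda mu Pp am) (interaction lambda Pp am) x) y).
    apply/funext => x; apply/funext => y; apply: eq_bigr => i _.
    by rewrite spin_prob_linear.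
  rewrite Q_lin in mark.
  set q := lin_prob _ _ in mark.
  pose pi := stat_law X (env a).
  have pi_ge0 x : 0 <= pi x by exact: stat_law_ge0.
  have pi_sum1 : \sum_x pi x = 1 by exact: stat_law_sum1.
  have pi_step f : statE pi (step q f) = statE pi f by exact: stat_law_step.
  pose G (s : nat -> {ffun 'I_N -> bool}) := ~~ [forall j,
    `|sigma_ag (path_sample s) T j 0 -
      \sum_i cov pi j i * colsum (interaction lambda Pp am) i| <= 3 * z].
  have noise : pathE q pi T (fun s => (G s)%:R) <= 4 / T%:R.
    rewrite KcE in KcT; exact: (sigma_ag_noise_prob hlambda N0 (interaction_small Pp am N0 hlambda)
      (lin_prob01 Pp am N0 hlambda hmu) pi_ge0 pi_sum1 pi_step z0 T2 L1 NT zT KcT).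
  have Gloc s s' : (forall k, (k <= T)%N -> s k = s' k) -> G s = G s'.
    by move=> ss'; rewrite /G (eq_path_sample _ ss').
  apply: le_trans (_ : pr P ([set w | G (path X w)] `&` env a) <= _); last first.
    by rewrite (pr_path (menv a) E0 mark Gloc) ler_wpM2l ?pr_ge0.
  apply: le_pr => //.
    by apply: measurableI => //; exact: measurable_path_pred Gloc.
  move=> w [Mw Ew]; split => //=; apply: contraT; rewrite negbK => /forallP close.
  have PE : Phat w = Pp.
    apply: (recovery hlambda hp r00 N0 hmu fP fM _ _ Ndel pi_ge0 pi_sum1 pi_step close).
    - by rewrite aE.
    - by rewrite aE.
    - by move: (hclust w); rewrite sample_path; exact.
  move: Mw; rewrite /M /= PE /misclassification_rate.
  rewrite finset.setICr [_ :&: Pp]finset.setIC finset.setICr cards0 mulr0 mul1r.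
  (* Exact recovery makes the misclassification rate 0, strictly below the positive threshold, so
     [w] cannot lie in M. *)
  suff : 0 < N%:R * ln T%:R * ln (N%:R * ln T%:R) / T%:R + ln N%:R / N%:R :> R.
    by rewrite ltNge => /negPf ->.
  apply: ltr_wpDr; first by rewrite divr_ge0// ln_ge0// ler1n.
  by rewrite divr_gt0// mulr_gt0// mulr_gt0//; lra.
rewrite prE// lee_fin (@pr_split _ _ _ _ _ (fun w => [ffun ij => theta ij w]) _ menv mM).
apply: le_trans (ler_sum _ (fun a _ => prM a)) _.
have bad : \sum_a bern_weight (fun=> p) a * ((~~ good a)%:R + 4 / T%:R) <=
    c4 * N%:R^-1 + 4 / T%:R.
  apply: (@le_trans _ _ (bernE (fun=> p) (fun a => ((~~ balanced p del Pp a)%:R +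
      (~~ balanced p del (~: Pp) a)%:R) + 4 / T%:R))).
    apply: le_bernE => // a; rewrite lerD2r /good negb_and.
    by case: (balanced _ _ Pp _); case: (balanced _ _ _ _); rewrite /= ?addr0 ?add0r// lerDl.
  rewrite !bernED bernE_cst lerD2r.
  have -> : c4 * N%:R^-1 = 512 / (del ^+ 4 * N%:R) + 512 / (del ^+ 4 * N%:R).
    by rewrite c4E; field; rewrite !gt_eqF.
  by apply: lerD; exact: balanced_prob.
apply: le_trans bad _.
have sq := @inv_le_sqrt_ratio R N T N0 T0; have s0 := sqrtr_ge0 (N%:R / T%:R : R).
have iN : 0 <= N%:R^-1 :> R by rewrite invr_ge0.
have fin_bound (k s n t : R) : 0 <= k -> t <= s -> 0 <= s -> 0 <= n ->
    k * n + 4 * t <= (k + 4) * (s + n).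
  by move=> k0 ts s0' n0; have := mulr_ge0 k0 s0'; lra.
exact: fin_bound (ltW c40) sq s0 iN.
Qed.
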